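(* Let $n,d\in\mathbb{N}$ and $\phi\in C_c^\infty(\mathbb{C}^n)$. There is a constant $C_{d,n,\phi}$, depending only on $d$, $n$ and $\phi$, such that for every complex polynomial $f\in\mathbb{C}[X_1,\ldots,X_n]$ of degree $d$, $$|I_\phi(f)|\ \le\ C_{d,n,\phi}\, H_{f,\phi}^{-2}.$$
   Context: For $z=x+iy\in\mathbb{C}$ (with $x,y$ real) put $\mathrm{e}(z)=e^{2\pi i x}e^{2\pi i y}$. For $f:\mathbb{C}^n\to\mathbb{C}$ and $\phi\in C_c^\infty(\mathbb{C}^n)$ (smooth in the real sense on $\mathbb{C}^n\simeq\mathbb{R}^{2n}$), $$I_\phi(f)=\int_{\mathbb{C}^n}\mathrm{e}(f(\underline z))\,\phi(\underline z)\,d\underline z,$$ where $d\underline z$ is Lebesgue measure on $\mathbb{C}^n\simeq\mathbb{R}^{2n}$. For a polynomial $f\in\mathbb{C}[X_1,\dots,X_n]$, with complex partial derivatives $\partial^\alpha$, $\alpha\in\mathbb{N}^n$, $|\alpha|=\alpha_1+\cdots+\alpha_n$, $\alpha!=\alpha_1!\cdots\alpha_n!$, $$H_f(\underline z)=\max_{|\alpha|\ge1}\bigl|\partial^\alpha f(\underline z)/\alpha!\bigr|^{1/|\alpha|},\qquad H_{f,\phi}=\inf_{\underline z\in\mathrm{supp}(\phi)}H_f(\underline z).$$ If $H_{f,\phi}=0$ the right-hand side is interpreted as $+\infty$. *)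

(* Defs.v *)
From HB Require Import structures.
From mathcomp Require Import all_boot all_order all_algebra.
From mathcomp.real_closed Require Import complex.
(* The notations of mpoly clash with those of MathComp-Analysis, which has to
   come last since both libraries define isMeasure. *)
From mathcomp.multinomials Require Import -(notations) mpoly.
From mathcomp Require Import all_classical all_reals all_analysis.

Set Implicit Arguments.
Unset Strict Implicit.
Unset Printing Implicit Defensive.

Import Order.TTheory GRing.Theory Num.Theory.
Import numFieldNormedType.Exports Normc.

Local Open Scope classical_set_scope.
Local Open Scope ring_scope.
Local Open Scope complex_scope.

(* Lebesgue measure on R^m: the iterated product of the one-dimensional
   Lebesgue measure, transported along (x, (x_1, .., x_m)) |-> (x, x_1, .., x_m);
   R^0 is a point of mass 1. *)
Section lebesgue_tuple.
Context {R : realType}.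

Definition pcons m (p : measurableTypeR R * m.-tuple (measurableTypeR R)) :
  m.+1.-tuple (measurableTypeR R) := [tuple of p.1 :: p.2].

Lemma measurable_pcons m : measurable_fun setT (@pcons m).
Proof. exact: measurable_cons. Qed.

Section step.
Variables (m : nat)
  (mu : {sigma_finite_measure set (m.-tuple (measurableTypeR R)) -> \bar R}).

Definition lebesgue_cons : set (m.+1.-tuple (measurableTypeR R)) -> \bar R :=
  pushforward (lebesgue_measure \x mu)%E (@pcons m).

Let lebesgue_cons0 : lebesgue_cons set0 = 0%E.
Proof. by rewrite /lebesgue_cons /pushforward preimage_set0 measure0. Qed.

Let lebesgue_cons_ge0 A : (0 <= lebesgue_cons A)%E.
Proof. by rewrite /lebesgue_cons /pushforward measure_ge0. Qed.

Let lebesgue_cons_sigma_additive : semi_sigma_additive lebesgue_cons.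
Proof.
have mp (A : set (m.+1.-tuple (measurableTypeR R))) :
    measurable A -> measurable (@pcons m @^-1` A).
  by move=> mA; rewrite -[X in measurable X]setTI; exact: measurable_pcons.
move=> F mF tF mUF; rewrite /lebesgue_cons /pushforward preimage_bigcup.
apply: measure_semi_sigma_additive.
- by move=> k; exact: mp.
- apply/trivIsetP => /= i j _ _ ij; rewrite -preimage_setI.
  by move/trivIsetP : tF => /(_ _ _ _ _ ij) ->//; rewrite preimage_set0.
- by rewrite -preimage_bigcup; exact: mp.
Qed.

HB.instance Definition _ := isMeasure.Build _ _ _ lebesgue_cons
  lebesgue_cons0 lebesgue_cons_ge0 lebesgue_cons_sigma_additive.

Let lebesgue_cons_sigma_finite : sigma_finite setT lebesgue_cons.
Proof.
have /sigma_finiteP[F [TF ndF Foo]] := sigma_finiteT (@lebesgue_measure R).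
have /sigma_finiteP[G [TG ndG Goo]] := sigma_finiteT mu.
pose uncons (t : m.+1.-tuple (measurableTypeR R)) :=
  (thead t, [tuple of behead t]).
have muncons : measurable_fun setT uncons.
  apply/measurable_fun_pairP; split; first exact: measurable_tnth.
  exact: measurable_behead.
exists (fun k => uncons @^-1` (F k `*` G k)).
  apply/seteqP; split => // t _.
  have [k _ Fk] : (\bigcup_k F k) (uncons t).1 by rewrite -TF.
  have [l _ Gl] : (\bigcup_k G k) (uncons t).2 by rewrite -TG.
  exists (maxn k l) => //; split.
    by move: Fk; exact/subsetPset/ndF/leq_maxl.
  by move: Gl; exact/subsetPset/ndG/leq_maxr.
move=> k; have [mF Fk] := Foo k; have [mG Gk] := Goo k.
have mFG : measurable (F k `*` G k) by exact: measurableX.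
split; first by rewrite -[X in measurable X]setTI; exact: muncons.
rewrite /lebesgue_cons /pushforward -comp_preimage.
rewrite (_ : uncons \o @pcons m = id).
  by rewrite preimage_id product_measure1E// lte_mul_pinfty// ge0_fin_numE.
apply/funext => -[x t]; rewrite /uncons /pcons/=; congr pair.
by apply/val_inj.
Qed.

HB.instance Definition _ := Measure_isSigmaFinite.Build _ _ _ lebesgue_cons
  lebesgue_cons_sigma_finite.

End step.

Fixpoint lebesgue_tuple (m : nat) :
    {sigma_finite_measure set (m.-tuple (measurableTypeR R)) -> \bar R} :=
  match m with
  | 0 => dirac [tuple]
  | m'.+1 => lebesgue_cons (lebesgue_tuple m')
  end.

End lebesgue_tuple.

Lemma lebesgue_tupleE (R : realType) m (A : 'I_m -> set (measurableTypeR R)) :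
  (forall i, measurable (A i)) ->
  lebesgue_tuple m [set t | forall i, A i (tnth t i)] =
  (\prod_(i < m) lebesgue_measure (A i))%E.
Proof.
elim: m A => [|m IH] A mA.
  by rewrite big_ord0 /= diracE mem_set// => -[].
rewrite big_ord_recl -(IH (fun i => A (lift ord0 i)))//= /lebesgue_cons.
rewrite -product_measure1E//; last first.
  rewrite (_ : mkset _ = \bigcap_(i in [set: 'I_m])
      ((fun t => tnth t i) @^-1` A (lift ord0 i))); last first.
    by apply/seteqP; split=> t At i; [move=> _|]; exact: At.
  apply: fin_bigcap_measurable => // i _.
  by rewrite -[X in measurable X]setTI; exact: measurable_tnth.
congr ((_ \x _)%E _); apply/seteqP; split => -[x t] /=.
  by move=> At; split=> [|i]; [exact: (At ord0)|rewrite -(tnthS x)].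
by move=> [Ax At] i; case: (unliftP ord0 i) => [j|] ->//; rewrite tnthS.
Qed.

Section oscillatory_integral.
Context {R : realType}.
Implicit Types (n m : nat).

Definition pderiv m (i : 'I_m) (g : 'rV[R]_m -> R) : 'rV[R]_m -> R :=
  fun x => 'D_(delta_mx 0 i) g x.

(* C^oo: all iterated partial derivatives exist and are continuous. *)
Definition smooth m (g : 'rV[R]_m -> R) : Prop :=
  forall s : seq 'I_m,
    continuous (foldr (@pderiv m) g s) /\
    forall i x, derivable (foldr (@pderiv m) g s) x (delta_mx 0 i).

(* The identification R^{2n} ~ C^n, (x, y) |-> x + iy. *)
Definition toC n (x : 'rV[R]_(n + n)) : 'rV[R[i]]_n :=
  \row_j (x 0 (lshift n j) +i* x 0 (rshift n j)).

(* R[i] carries no topology here, so closures and compactness are taken on the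
   R^{2n} side. *)
Definition real_supp n (phi : 'rV[R[i]]_n -> R[i]) : set 'rV[R]_(n + n) :=
  closure [set x | phi (toC x) != 0].

Definition supp n (phi : 'rV[R[i]]_n -> R[i]) : set 'rV[R[i]]_n :=
  @toC n @` real_supp phi.

Definition Cc_smooth n (phi : 'rV[R[i]]_n -> R[i]) : Prop :=
  [/\ smooth (fun x => complex.Re (phi (toC x))),
      smooth (fun x => complex.Im (phi (toC x))) &
      compact (real_supp phi)].

Definition cis (t : R) : R[i] := cos t +i* sin t.

Definition e_ (z : R[i]) : R[i] :=
  cis (2 * pi * complex.Re z) * cis (2 * pi * complex.Im z).

Definition integralC n (g : 'rV[R[i]]_n -> R[i]) : R[i] :=
  let G (t : (n + n).-tuple (measurableTypeR R)) :=
    g (toC (\row_j (tnth t j : R))) in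
  (\int[lebesgue_tuple (n + n)]_t complex.Re (G t)) +i*
  (\int[lebesgue_tuple (n + n)]_t complex.Im (G t)).

Definition I_ n (phi : 'rV[R[i]]_n -> R[i]) (f : 'rV[R[i]]_n -> R[i]) : R[i] :=
  integralC (fun z => e_ (f z) * phi z).

Definition evalC n (f : mpoly n R[i]) (z : 'rV[R[i]]_n) : R[i] :=
  meval (z 0) f.

(* mmeasure mdeg f, i.e. msize f, is 1 + the total degree of f, and 0 if f = 0. *)
Definition has_degree n (d : nat) (f : mpoly n R[i]) : Prop :=
  mmeasure mdeg f = d.+1.

Definition mfactorial n (a : multinom n) : nat := (\prod_(i < n) (a i)`!)%N.

Definition Hterm n (f : mpoly n R[i]) (z : 'rV[R[i]]_n) (a : multinom n) : R :=
  normc (evalC (mderivm a f) z / (mfactorial a)%:R) `^ ((mdeg a)%:R^-1).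

(* For n = 0 there is no multi-index of positive degree and H_ is 0. For n > 0
   the supremum is attained, see H_max. *)
Definition H_ n (f : mpoly n R[i]) (z : 'rV[R[i]]_n) : R :=
  sup [set Hterm f z a | a in [set a : multinom n | (0 < mdeg a)%N]].

(* The infimum over an empty support is +oo. *)
Definition Hinf n (f : mpoly n R[i]) (phi : 'rV[R[i]]_n -> R[i]) : \bar R :=
  ereal_inf [set (H_ f z)%:E | z in supp phi].

Lemma mderivm_eq0 n (f : mpoly n R[i]) (a : multinom n) :
  (mmeasure mdeg f <= mdeg a)%N -> mderivm a f = 0.
Proof.
move=> fa; apply/mpolyP => m.
rewrite mcoeff_mderivm mcoeff0 memN_msupp_eq0 ?mul0rn//.
by apply: msize_mdeg_ge; rewrite (leq_trans fa)// mdegD leq_addr.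
Qed.

Lemma Hterm_eq0 n (f : mpoly n R[i]) z (a : multinom n) :
  (mmeasure mdeg f <= mdeg a)%N -> (0 < mdeg a)%N -> Hterm f z a = 0.
Proof.
move=> fa a0; rewrite /Hterm mderivm_eq0// /evalC meval0 mul0r normc0.
by rewrite powR0// invr_eq0 pnatr_eq0 -lt0n.
Qed.

Lemma H_max n (f : mpoly n.+1 R[i]) (z : 'rV[R[i]]_n.+1) :
  (exists2 a, (0 < mdeg a)%N & H_ f z = Hterm f z a) /\
  (forall a, (0 < mdeg a)%N -> Hterm f z a <= H_ f z).
Proof.
set k := (mmeasure mdeg f).+2.
have U1 : (mdeg (mnm1 ord0 : multinom n.+1) < k)%N by rewrite mdeg1.
have U0 : (0 < mdeg (BMultinom U1))%N by rewrite /= mdeg1.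
pose b : bmultinom n.+1 k :=
  [arg max_(c > BMultinom U1 | (0 < mdeg c)%N) Hterm f z c]%O.
have [b0 bmax] : (0 < mdeg b)%N /\
    forall a : multinom n.+1, (0 < mdeg a)%N -> Hterm f z a <= Hterm f z b.
  rewrite /b; case: arg_maxP => //= c c0 cmax; split=> // a a0.
  have [ak|ka] := ltnP (mdeg a) k; first exact: (cmax (BMultinom ak)).
  by rewrite Hterm_eq0 ?powR_ge0// (leq_trans _ ka)// /k -addn2 leq_addr.
have -> : H_ f z = Hterm f z b.
  apply/eqP; rewrite eq_le; apply/andP; split.
    apply: ge_sup; first by exists (Hterm f z b), b.
    by move=> _ [a a0 <-]; exact: bmax.
  apply: ub_le_sup; last by exists b.
  by exists (Hterm f z b) => _ [a a0 <-]; exact: bmax.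
by split=> //; exists b.
Qed.

End oscillatory_integral.

(* Main.v *)
(* Write h for the infimum of H_f over the support; we may take h >= 1. Put
   A_a = h^-|a| d^a f and Q = sum_(1 <= |a| <= d) |A_a|^2, so that Q >= 1 on the
   support, while Q > 0 everywhere since the derivatives of top order are
   constant. The normalized jets A_a / sqrt Q are bounded by 1 and are given
   weight |a| - 1; since d(A_a) = h A_(a + e_k), applying h^-1 d to a polynomial
   in the real and imaginary parts of the normalized jets and in 1 / sqrt Q
   raises its weight by 1. Now 1 is the sum of a multiple of |grad f|^2 / (h^2 Q),
   which one integrates by parts against the phase, and of terms with |a| >= 2,
   which already have positive weight. Iterating, the integral reduces to terms
   with a factor h^-2 and to terms of weight at least 4.

   For the latter, a symbol of weight w is bounded by the w/2-th power of the sum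
   of the ratios |g'|^2 / (|g'|^2 + h^2 |g|^2), where g is a derivative of f of
   positive order and g' one of its partial derivatives. On a complex line
   parallel to the corresponding axis, g'/g = sum_i 1 / (w - z_i) over the roots
   of g, so the square of the ratio is at most a constant times
   sum_i 1 / ((1 + h^2 (x - x_i)^2) (1 + h^2 (y - y_i)^2)), of integral O(h^-2). *)

Require Import Defs.
From mathcomp Require Import all_boot all_order all_algebra.
From mathcomp.real_closed Require Import complex.
From mathcomp.multinomials Require Import -(notations) mpoly.
From mathcomp Require Import all_classical all_reals all_analysis.
From mathcomp Require Import measurable_realfun.
From mathcomp Require Import ring lra.

Set Implicit Arguments.
Unset Strict Implicit.
Unset Printing Implicit Defensive.

Import Order.TTheory GRing.Theory Num.Theory.
Import numFieldNormedType.Exports Normc.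

Local Open Scope classical_set_scope.
Local Open Scope ring_scope.
Local Open Scope complex_scope.

(** * Integration over R^m one coordinate at a time *)

Section coordinate_integrals.
Context {R : realType}.
Local Notation tup m := (m.-tuple (measurableTypeR R)).

Definition upd m (t : tup m) (i : 'I_m) (x : R) : tup m :=
  [tuple if j == i then x else tnth t j | j < m].

Lemma measurable_upd m (i : 'I_m) :
  measurable_fun setT (fun p : tup m * measurableTypeR R => upd p.1 i p.2).
Proof.
apply/measurable_fun_tnthP => j; rewrite /comp /=.
under eq_fun do rewrite tnth_mktuple.
case: (j == i); first exact: measurable_snd.
exact: (measurableT_comp (measurable_tnth j) measurable_fst).
Qed.

Lemma upd_pcons0 m (x y : R) (s : tup m) : upd (pcons (y, s)) ord0 x = pcons (x, s).
Proof.
apply: eq_from_tnth => j; rewrite tnth_mktuple.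
by case: (unliftP ord0 j) => [k|] -> //=; rewrite !tnthS.
Qed.

Lemma upd_pcons_lift m (i : 'I_m) (x y : R) (s : tup m) :
  upd (pcons (y, s)) (lift ord0 i) x = pcons (y, upd s i x).
Proof.
apply: eq_from_tnth => j; rewrite tnth_mktuple.
by case: (unliftP ord0 j) => [k|] -> //=; rewrite !tnthS tnth_mktuple.
Qed.

Local Open Scope ereal_scope.

(** Both orders of integration are recorded: [tonelli_coord] keeps the head coordinate outside when
    the updated coordinate lies in the tail, and inside when it is the head. *)
Lemma ge0_integral_lebesgue_cons m (W : tup m.+1 -> \bar R) :
  measurable_fun setT W -> (forall t, 0 <= W t) ->
  \int[lebesgue_tuple m.+1]_t W t =
  \int[lebesgue_tuple m]_s \int[lebesgue_measure]_x W (pcons (x, s)) /\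
  \int[lebesgue_tuple m.+1]_t W t =
  \int[lebesgue_measure]_x \int[lebesgue_tuple m]_s W (pcons (x, s)).
Proof.
move=> mW W0.
have E : \int[lebesgue_tuple m.+1]_t W t =
    \int[lebesgue_measure \x lebesgue_tuple m]_p W (pcons p).
  rewrite -(preimage_setT (@pcons R m)) -ge0_integral_pushforward//.
  exact: measurable_pcons.
have mWp : measurable_fun setT (fun p => W (@pcons R m p)).
  exact: (measurableT_comp mW (@measurable_pcons R m)).
by split; rewrite E; [rewrite fubini_tonelli2|rewrite fubini_tonelli1] => // p; exact: W0.
Qed.

Lemma measurable_integral_upd m (i : 'I_m) (W : tup m -> \bar R) :
  measurable_fun setT W -> (forall t, 0 <= W t) ->
  measurable_fun setT (fun t => \int[lebesgue_measure]_x W (upd t i x)).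
Proof.
move=> mW W0.
apply: (@measurable_fun_fubini_tonelli_F _ _ (tup m) (measurableTypeR R) R
  lebesgue_measure (fun p => W (upd p.1 i p.2))) => //.
exact: (measurableT_comp mW (@measurable_upd m i)).
Qed.

Lemma integral_indic01 : \int[@lebesgue_measure R]_x (\1_`[0%R, 1%R] x)%:E = 1.
Proof.
rewrite integral_indic// setIT.
by apply: (etrans (@lebesgue_measure_itv R `[0%R, 1%R])); rewrite /= lte_fin ltr01 oppr0 adde0.
Qed.

(* The indicator keeps the coordinate [t_i], on which the inner integral does
   not depend, so that both sides live on the same space. *)
Lemma tonelli_coord m (i : 'I_m) (W : tup m -> \bar R) :
  measurable_fun setT W -> (forall t, 0 <= W t) ->
  \int[lebesgue_tuple m]_t W t =
  \int[lebesgue_tuple m]_t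
    ((\1_`[0%R, 1%R] (tnth t i : R))%:E * \int[lebesgue_measure]_x W (upd t i x)).
Proof.
elim: m i W => [[]//|m IH] i W mW W0.
have mind k (l : 'I_k) : measurable_fun setT
    (fun t : tup k => (\1_(`[0%R, 1%R]%classic : set R) (tnth t l : R))%:E : \bar R).
  apply/measurable_EFinP.
  have mt : measurable_fun setT (fun t : tup k => tnth t l) := measurable_tnth l.
  apply: (measurableT_comp _ mt).
  by apply: measurable_indic; exact: measurable_itv.
have mRHS : measurable_fun setT (fun t : tup m.+1 =>
    (\1_(`[0%R, 1%R]%classic : set R) (tnth t i : R))%:E *
    \int[lebesgue_measure]_x W (upd t i x)).
  apply: emeasurable_funM; first exact: mind.
  exact: (measurable_integral_upd i mW W0).
have RHS0 (t : tup m.+1) : 0 <= (\1_(`[0%R, 1%R]%classic : set R) (tnth t i : R))%:E *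
     \int[lebesgue_measure]_x W (upd t i x).
  by apply: mule_ge0; [rewrite lee_fin indicE ler0n|apply: integral_ge0 => x _; exact: W0].
have mWp : measurable_fun setT (fun p => W (@pcons R m p)).
  exact: (measurableT_comp mW (@measurable_pcons R m)).
have [L1 L2] := ge0_integral_lebesgue_cons mW W0.
have [R1 R2] := ge0_integral_lebesgue_cons mRHS RHS0.
(* For a coordinate of the tail the induction hypothesis applies at each fixed head. For the head,
   the inner integral is constant in the old head, over which the indicator integrates to 1. *)
case: (unliftP ord0 i) => [j|] Ei; rewrite {}Ei in mRHS RHS0 R1 R2 *.
  rewrite L2 R2; apply: eq_integral => x _.
  rewrite (IH j (fun s => W (pcons (x, s)))) //.
    apply: eq_integral => s _; rewrite tnthS.
    congr (_ * _); apply: eq_integral => y _.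
    by rewrite upd_pcons_lift.
  exact: (measurableT_comp mWp (measurable_pair1 x)).
rewrite L1 R1; apply: eq_integral => s _.
under [RHS]eq_integral => x _.
  rewrite (_ : \int[lebesgue_measure]_y W (upd (pcons (x, s)) ord0 y) =
    \int[lebesgue_measure]_y W (pcons (y, s))); last first.
    by apply: eq_integral => y _; rewrite upd_pcons0.
  rewrite /= [tnth _ _]/=.
  over.
rewrite ge0_integralZr//; first by rewrite integral_indic01 mul1e.
- by apply/measurable_EFinP; apply: measurable_indic; exact: measurable_itv.
- by apply: integral_ge0.
Qed.

End coordinate_integrals.

(** * Measurability of continuous functions, integrals of partial derivatives *)

Section euclidean.
Context {R : realType}.
Local Notation tup m := (m.-tuple (measurableTypeR R)).

(** Passes from tuples, which carry the measure, to row vectors, which carry the topology and the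
    derivatives. *)
Definition rowt m (t : tup m) : 'rV[R]_m := \row_j (tnth t j : R).

Lemma rowt_upd m (t : tup m) (i : 'I_m) (x h : R) :
  rowt (upd t i (h + x)) = h *: delta_mx 0 i + rowt (upd t i x).
Proof.
apply/rowP => j; rewrite !mxE !tnth_mktuple eqxx /=.
by case: (j == i); rewrite ?mulr1 ?mulr0 ?add0r.
Qed.

Lemma is_derive_line m (G : 'rV[R]_m -> R) (i : 'I_m) (t : tup m) (x l : R) :
  is_derive (rowt (upd t i x)) (delta_mx 0 i) G l ->
  is_derive x 1 (fun y => G (rowt (upd t i y))) l.
Proof.
move=> [dG <-].
have E : (fun h : R => h^-1 *: ((fun y => G (rowt (upd t i y))) (h *: 1 + x) -
      (fun y => G (rowt (upd t i y))) x)) =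
    (fun h : R => h^-1 *: (G (h *: delta_mx 0 i + rowt (upd t i x)) -
      G (rowt (upd t i x)))).
  by apply/funext => h; rewrite -rowt_upd /GRing.scale/= mulr1.
split; first by rewrite /derivable E.
by rewrite /derive E.
Qed.

Lemma continuous_line m (G : 'rV[R]_m -> R) (i : 'I_m) (t : tup m) :
  continuous G -> continuous (fun y : R => G (rowt (upd t i y))).
Proof.
move=> cG x; apply: continuous_comp; last exact: cG.
apply/cvg_ballP => e e0; near=> y; split=> // k j.
rewrite !mxE !tnth_mktuple; case: (j == i); last exact: ballxx.
near: y; change (nbhs (x : R) (ball (x : R) e)); exact: nbhsx_ballx.
Unshelve. all: by end_near. Qed.

Lemma measurable_floor_fiber m (c : R) (v : m.-tuple int) :
  measurable [set t : tup m | [tuple Num.floor (c * (tnth t j : R)) | j < m] = v].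
Proof.
rewrite (_ : mkset _ = \bigcap_(j in [set: 'I_m])
   ((fun t : tup m => c * (tnth t j : R)) @^-1` `[(tnth v j)%:~R, (tnth v j + 1)%:~R[)).
  apply: fin_bigcap_measurable => // j _.
  rewrite -[X in measurable X]setTI.
  have mj : measurable_fun setT (fun t : tup m => tnth t j) := measurable_tnth j.
  have mc : measurable_fun setT (fun t : tup m => c * (tnth t j : R)).
    by apply: measurable_funM => //.
  by apply: mc => //; exact: measurable_itv.
apply/seteqP; split => t /=.
  by move=> <- j _; rewrite tnth_mktuple /= in_itv /= floor_itv.
move=> H; apply: eq_from_tnth => j; rewrite tnth_mktuple.
by apply/eqP; rewrite floor_eq; have := H j I; rewrite /= in_itv.
Qed.

(** [G] is the pointwise limit of its values at the corners of grids of mesh [1 / k.+1]; each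
    approximation is constant on each of countably many cells, measurable by
    [measurable_floor_fiber]. *)
Lemma continuous_rowt_measurable m (G : 'rV[R]_m -> R) :
  continuous G -> measurable_fun setT (fun t : tup m => G (rowt t)).
Proof.
move=> cG.
pose fl k (t : tup m) := [tuple Num.floor (k.+1%:R * (tnth t j : R)) | j < m].
pose g k (v : m.-tuple int) : 'rV[R]_m := \row_j ((tnth v j)%:~R / k.+1%:R).
apply: (@measurable_fun_cvg _ _ _ _ (fun k t => G (g k (fl k t)))).
  move=> k _ Y mY; rewrite setTI.
  rewrite (_ : _ @^-1` Y = \bigcup_(v in [set v | Y (G (g k v))]) [set t | fl k t = v]).
    rewrite bigcup_mkcond; apply: countable_bigcupT_measurable => // v.
    by case: ifP => _ //; exact: measurable_floor_fiber.
  apply/seteqP; split => [t /= Yt|t [v /= Yv E]]; first by exists (fl k t).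
  by rewrite -E in Yv.
move=> t _; apply: (cvg_comp (fun k => g k (fl k t)) G _ (cG (rowt t))).
apply/cvg_ballP => e e0; near=> k; split=> // i j.
rewrite /ball/= !mxE tnth_mktuple.
have k0 : 0 < k.+1%:R :> R by [].
have ke : k.+1%:R^-1 < e.
  by near: k; exact: (near_infty_natSinv_lt (PosNum e0)).
apply: le_lt_trans ke; have /andP[f1 f2] := floor_itv (k.+1%:R * (tnth t j : R)).
set z := Num.floor _ in f1 f2 *.
have e1 : z%:~R / k.+1%:R <= (tnth t j : R) by rewrite ler_pdivrMr// [leRHS]mulrC.
have e2 : (tnth t j : R) < z%:~R / k.+1%:R + k.+1%:R^-1.
  by rewrite -[X in _ + X]mul1r -mulrDl ltr_pdivlMr// [ltLHS]mulrC -[1]/(1%:~R) -intrD.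
rewrite ger0_norm ?subr_ge0// lerBlDl; exact: ltW.
Unshelve. all: by end_near. Qed.

Local Open Scope ereal_scope.

(** By the fundamental theorem of calculus [u'] has integral 0 over an interval outside of which it
    vanishes. Comparing positive and negative parts lets the result be used inside the two Tonelli
    integrals of [Rintegral_partial0]. *)
Lemma integral_derive1_compact (u u' : R -> R) (B : R) :
  (0 < B)%R ->
  (forall x : R, is_derive x 1%R u (u' x)) -> continuous u' ->
  (forall x, (B < `|x|)%R -> u x = 0%R) -> (forall x, (B < `|x|)%R -> u' x = 0%R) ->
  \int[lebesgue_measure]_x maxe (u' x)%:E 0 =
  \int[lebesgue_measure]_x maxe (- (u' x)%:E) 0.
Proof.
move=> B0 du cu' u0 u'0.
(* One unit beyond [B], so that [u] vanishes at both ends of the interval. *)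
pose b := (B + 1)%R.
have bB : (B < `|b|)%R by rewrite /b ger0_norm; [lra|lra].
have bBN : (B < `|(- b)|)%R by rewrite normrN.
have cu : continuous u.
  by move=> x; apply/differentiable_continuous/derivable1_diffP; case: (du x).
have FTC : \int[lebesgue_measure]_(x in `[(- b)%R, b]) (u' x)%:E = 0.
  rewrite (@continuous_FTC2 _ u' u)//.
  - by rewrite !u0// subee.
  - by rewrite /b; lra.
  - exact: continuous_subspaceT.
  - split => [x _||]; first by case: (du x).
      exact: cvg_at_right_filter (cu _).
    exact: cvg_at_left_filter (cu _).
  - by move=> x _; rewrite derive1E; have [_ ->] := du x.
have out (g : \bar R -> \bar R) : g 0 = 0 ->
    \int[lebesgue_measure]_x g (u' x)%:E =
    \int[lebesgue_measure]_(x in `[(- b)%R, b]) g (u' x)%:E.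
  move=> g0; rewrite [RHS]integral_mkcond; apply: eq_integral => x _.
  rewrite patchE; case: ifPn => // xb; rewrite u'0//.
  rewrite ltNge; apply: contra xb => xB; rewrite inE /= in_itv /=.
  by move: xB; rewrite ler_norml => /andP[? ?]; apply/andP; split; rewrite /b; lra.
have iu : (@lebesgue_measure R).-integrable `[(- b)%R, b] (EFin \o u').
  apply: continuous_compact_integrable; first exact: segment_compact.
  exact: continuous_subspaceT.
have E1 : \int[lebesgue_measure]_x ((EFin \o u')^\+ x) =
   \int[lebesgue_measure]_(x in `[(- b)%R, b]) ((EFin \o u')^\+ x).
  have := out (fun y => maxe y 0). rewrite maxxx => /(_ erefl) H.
  rewrite (_ : _^\+ = (fun x => maxe (u' x)%:E 0)) //.
  by apply/funext => x; rewrite funeposE.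
have E2 : \int[lebesgue_measure]_x ((EFin \o u')^\- x) =
   \int[lebesgue_measure]_(x in `[(- b)%R, b]) ((EFin \o u')^\- x).
  have := out (fun y => maxe (- y) 0); rewrite oppe0 maxxx => /(_ erefl) H.
  rewrite (_ : _^\- = (fun x => maxe (- (u' x)%:E) 0)) //.
  by apply/funext => x; rewrite funenegE.
have F1 : \int[lebesgue_measure]_x maxe (u' x)%:E 0 =
   \int[lebesgue_measure]_x ((EFin \o u')^\+ x).
  by apply: eq_integral => x _; rewrite funeposE.
have F2 : \int[lebesgue_measure]_x maxe (- (u' x)%:E) 0 =
   \int[lebesgue_measure]_x ((EFin \o u')^\- x).
  by apply: eq_integral => x _; rewrite funenegE.
rewrite F1 F2 E1 E2; move: FTC; rewrite integralE.
have mI : measurable (`[(- b)%R, b]%classic : set (measurableTypeR R)).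
  exact: measurable_itv.
have fp := integrable_pos_fin_num mI iu.
have fn := integrable_neg_fin_num mI iu.
move: fp fn; set P := integral _ _ _; set N := integral _ _ _.
case: P => // p _; case: N => // n _; rewrite -EFinB => -[/eqP].
by rewrite subr_eq0 => /eqP ->.
Qed.

Local Close Scope ereal_scope.

(* No integrability of [dG] is needed: on every line the positive and negative
   parts of [dG] have the same integral, and the junk value of [+oo - +oo] is
   mapped to 0 by [fine]. *)
Lemma Rintegral_partial0 m (i : 'I_m) (G dG : 'rV[R]_m -> R) (B : R) :
  (0 < B) ->
  (forall x : 'rV[R]_m, is_derive x (delta_mx 0 i) G (dG x)) -> continuous dG ->
  (forall x : 'rV[R]_m, (exists j, (B < `|x 0 j|)) -> G x = 0) ->
  (forall x : 'rV[R]_m, (exists j, (B < `|x 0 j|)) -> dG x = 0) ->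
  (\int[lebesgue_tuple m]_t dG (rowt t) = 0).
Proof.
move=> B0 dGP cdG G0 dG0.
have mdG : measurable_fun setT (fun t : tup m => dG (rowt t)).
  exact: continuous_rowt_measurable.
rewrite /Rintegral integralE.
rewrite (tonelli_coord i) => [|/=|t //]; last first.
  by apply: measurable_funepos; apply/measurable_EFinP.
rewrite [X in (_ - X)%E](tonelli_coord i) => [|/=|t //]; last first.
  by apply: measurable_funeneg; apply/measurable_EFinP.
set A := (X in (X - _)%E); set A' := (X in (_ - X)%E).
have -> : A = A'.
  apply: eq_integral => t _; congr (_ * _)%E.
  under eq_integral do rewrite funeposE; under [RHS]eq_integral do rewrite funenegE.
  apply: (@integral_derive1_compact (fun x => G (rowt (upd t i x)))
    (fun x => dG (rowt (upd t i x))) B B0).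
  - by move=> x; apply: is_derive_line.
  - exact: continuous_line.
  - by move=> x Bx; apply: G0; exists i; rewrite !mxE tnth_mktuple eqxx.
  - by move=> x Bx; apply: dG0; exists i; rewrite !mxE tnth_mktuple eqxx.
by case: A' => //= r; rewrite subrr.
Qed.

End euclidean.

(** * Integrals over boxes *)

Section boxes.
Context {R : realType}.
Local Notation tup m := (m.-tuple (measurableTypeR R)).

Definition box m (B : R) : set (tup m) :=
  [set t | forall j, (`[- B, B]%classic : set (measurableTypeR R)) (tnth t j)].

Lemma measurable_box m (B : R) : measurable (@box m B).
Proof.
rewrite (_ : box B = \bigcap_(j in [set: 'I_m])
   ((fun t : tup m => tnth t j) @^-1` (`[- B, B]%classic : set (measurableTypeR R)))).
  apply: fin_bigcap_measurable => // j _.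
  rewrite -[X in measurable X]setTI.
  have mj : measurable_fun setT (fun t : tup m => tnth t j) := measurable_tnth j.
  by apply: mj => //; exact: measurable_itv.
by apply/seteqP; split => t H => [j _|j]; exact: H.
Qed.

Lemma lebesgue_box m (B : R) : 0 <= B ->
  lebesgue_tuple m (box B) = ((2 * B) ^+ m)%:E.
Proof.
move=> B0; rewrite (@lebesgue_tupleE R m (fun=> `[- B, B]%classic)) => [|_]; last first.
  exact: measurable_itv.
rewrite (eq_bigr (fun=> (2 * B)%:E)) => [|i _]; last first.
  apply: (etrans (@lebesgue_measure_itv R `[- B, B])) => /=; rewrite lte_fin.
  by case: ltP => BB; congr EFin; lra.
by rewrite prodEFin prodr_const card_ord.
Qed.

Lemma box_integrable m (G : 'rV[R]_m -> R) (B : R) : 0 <= B -> continuous G ->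
  (forall x : 'rV[R]_m, (exists j, B < `|x ord0 j|) -> G x = 0) ->
  (lebesgue_tuple m).-integrable setT (fun t => (G (rowt t))%:E).
Proof.
move=> B0 cG G0.
have mG := continuous_rowt_measurable cG.
have cB : compact [set x : 'rV[R]_m | forall j, (`[- B, B]%classic : set R) (x ord0 j)].
  apply: (@rV_compact R^o m (fun=> `[- B, B]%classic)) => i.
  exact: segment_compact.
have [M [_ /(_ (M + 1))]] : bounded_set
    (G @` [set x : 'rV[R]_m | forall j, (`[- B, B]%classic : set R) (x ord0 j)]).
  apply: (@compact_bounded R R^o).
  apply: continuous_compact; last exact: cB.
  by apply: continuous_subspaceT => x; exact: cG.
rewrite ltrDl ltr01 => /(_ isT) GM.
have off (t : tup m) : ~ box B t -> G (rowt t) = 0.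
  move=> nb; apply: G0; apply: contra_notP nb => nj j.
  rewrite /= in_itv/= -ler_norml leNgt; apply/negP => Bj; apply: nj.
  by exists j; rewrite mxE.
rewrite (_ : (fun t => _) = (fun t : tup m => (G (rowt t))%:E) \_ (box B)); last first.
  apply/funext => t; rewrite patchE; case: ifPn => //; rewrite notin_setE => /off ->//.
have mbox := @measurable_box m B.
apply/(integrable_mkcond _ mbox).
apply: (@measurable_bounded_integrable _ _ _ (lebesgue_tuple m) (fun t => G (rowt t))).
- exact: measurable_box.
- by have := @lebesgue_box m B B0 => /= ->; exact: ltry.
- by apply: (@measurable_funS _ _ _ _ setT).
exists (M + 1); split; first exact: num_real.
move=> x Mx t bt; apply: le_trans (ltW Mx).
by apply: GM => /=; exists (rowt t) => //= j; rewrite mxE; exact: bt.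
Qed.

Lemma upd_neq m (t : tup m) (i j : 'I_m) (x : R) : i != j -> tnth (upd t j x) i = tnth t i.
Proof. by move=> ij; rewrite tnth_mktuple (negbTE ij). Qed.

Local Open Scope ereal_scope.

(** [tonelli_coord] is applied in the coordinates [i] and [j] to [W] cut off to the box. The
    resulting integrand is at most [M] times the indicator of the box, which integrates to [M] times
    the volume. *)
Lemma ge0_integral_box_le m (i j : 'I_m) (W : tup m -> \bar R) (B : R) (M : \bar R) :
  i != j -> (1 <= B)%R -> 0 <= M -> measurable_fun setT W -> (forall t, 0 <= W t) ->
  (forall t, \int[lebesgue_measure]_y \int[lebesgue_measure]_x W (upd (upd t j y) i x) <= M) ->
  \int[lebesgue_tuple m]_(t in box B) W t <= M * ((2 * B) ^+ m)%:E.
Proof.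
move=> ij B1 M0 mW W0 WM.
have mbox := @measurable_box m B.
rewrite integral_mkcond.
have mW' : measurable_fun setT (W \_ (box B)).
  by apply/(measurable_restrictT _ mbox); apply: (@measurable_funS _ _ _ _ setT).
have W'0 t : 0 <= (W \_ (box B)) t by rewrite patchE; case: ifP.
rewrite (tonelli_coord i mW' W'0).
pose ind (x : R) : \bar R := ((\1_(`[0%R, 1%R]%classic : set R) x : R))%:E.
have ind0 x : 0 <= ind x by rewrite lee_fin indicE ler0n.
have mind (l : 'I_m) : measurable_fun setT (fun t : tup m => ind (tnth t l)).
  apply/measurable_EFinP.
  have mt : measurable_fun setT (fun t : tup m => tnth t l) := measurable_tnth l.
  apply: (measurableT_comp _ mt).
  by apply: measurable_indic; exact: measurable_itv.
pose W2 t := ind (tnth t i) * \int[lebesgue_measure]_x (W \_ (box B)) (upd t i x).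
have mW2 : measurable_fun setT W2.
  by apply: emeasurable_funM; [exact: mind|exact: measurable_integral_upd].
have W20 t : 0 <= W2 t by apply: mule_ge0 => //; apply: integral_ge0.
rewrite -/(W2 _) (tonelli_coord j mW2 W20).
rewrite (_ : M * _ = \int[lebesgue_tuple m]_t (M * (\1_(box B) t)%:E)); last first.
  rewrite ge0_integralZl//.
  - by rewrite integral_indic// setIT; have /= -> // := @lebesgue_box m B; lra.
  - by apply/measurable_EFinP; exact: measurable_indic.
apply: ge0_le_integral => //.
- by move=> t _; apply: mule_ge0 => //; apply: integral_ge0.
- apply: emeasurable_funM; first exact: mind.
  exact: measurable_integral_upd.
- apply: measurable_funeM; apply/measurable_EFinP; exact: measurable_indic.
move=> t _; rewrite -/(ind _).
have [tj|tj] := boolP ((tnth t j : R) \in `[0%R, 1%R]); last first.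
  rewrite /ind indicE memNset ?mul0e; last by move/negP: tj.
  by apply: mule_ge0 => //; rewrite lee_fin indicE ler0n.
have [ti|ti] := boolP ((tnth t i : R) \in `[0%R, 1%R]); last first.
  rewrite integral0_eq ?mule0.
    by apply: mule_ge0 => //; rewrite lee_fin indicE ler0n.
  move=> y _; rewrite /W2 upd_neq// /ind indicE memNset ?mul0e//.
  by move/negP: ti.
rewrite /ind indicE mem_set ?mul1e//.
under eq_integral do rewrite /W2 upd_neq// /ind indicE mem_set ?mul1e//.
have [bt|nbt] := pselect (box B t).
  rewrite indicE mem_set// mule1; apply: le_trans (WM t).
  have mu (l : 'I_m) (s : tup m) : measurable_fun setT (fun x : measurableTypeR R => upd s l x).
    apply/measurable_fun_tnthP => k; rewrite /comp /=.
    under eq_fun do rewrite tnth_mktuple.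
    by case: (k == l); [exact: measurable_id|exact: measurable_cst].
  apply: ge0_le_integral => //.
  - by move=> y _; apply: integral_ge0.
  - exact: (measurableT_comp (measurable_integral_upd i mW' W'0) (mu j t)).
  - exact: (measurableT_comp (measurable_integral_upd i mW W0) (mu j t)).
  move=> y _; apply: ge0_le_integral => //.
  - exact: (measurableT_comp mW' (mu i _)).
  - exact: (measurableT_comp mW (mu i _)).
  - by move=> x _; rewrite patchE; case: ifP.
(* The indicators have put the coordinates [i] and [j] of [t] in [0, 1], which lies in [-B, B]. The
   coordinate that takes [t] out of the box is thus another one, left alone by both updates. *)
rewrite indicE memNset// mule0 integral0_eq// => y _.
apply: integral0_eq => x _; rewrite patchE memNset// => bu; apply: nbt => k.
have [->|ki] := eqVneq k i.
  by move: ti; rewrite /= !in_itv/= => /andP[? ?]; apply/andP; split; lra.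
have [->|kj] := eqVneq k j.
  by move: tj; rewrite /= !in_itv/= => /andP[? ?]; apply/andP; split; lra.
by have := bu k; rewrite upd_neq// upd_neq.
Qed.

End boxes.

(** * One complex variable: logarithmic derivatives of polynomials *)

Section root_estimates.
Context {R : realType}.

(** The integral of a nonnegative function is a supremum over the simple functions below it, and
    this supremum is monotone. *)
Lemma ge0_le_integral_nomeas d (T : measurableType d) (mu : {measure set T -> \bar R})
    (f g : T -> \bar R) :
  (forall x, 0 <= f x)%E -> (forall x, f x <= g x)%E ->
  (\int[mu]_x f x <= \int[mu]_x g x)%E.
Proof.
move=> f0 fg.
have g0 x : (0 <= g x)%E by exact: le_trans (f0 x) (fg x).
rewrite !ge0_integralTE//; apply: le_ereal_sup => _ [k kf <-].
by exists k => // x; exact: le_trans (kf x) (fg x).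
Qed.

Definition cauchy_kernel (h x0 x : R) : R := (1 + (h * (x - x0)) ^+ 2)^-1.

Lemma cauchy_kernel_ge0 h x0 x : 0 <= cauchy_kernel h x0 x.
Proof. by rewrite invr_ge0 addr_ge0// sqr_ge0. Qed.

Lemma cauchy_kernel_den_gt0 (h x0 x : R) : 0 < 1 + (h * (x - x0)) ^+ 2.
Proof. by rewrite ltr_pwDl// sqr_ge0. Qed.

Lemma is_derive_atan_scale (h x0 x : R) : 0 < h ->
  is_derive x 1 (fun y => h^-1 * atan (h * (y - x0))) (cauchy_kernel h x0 x).
Proof.
move=> h0; have hn : h != 0 by rewrite gt_eqF.
have d1 : is_derive x 1 (fun y : R => h * (y - x0)) h.
  rewrite [X in is_derive _ _ X](_ : _ = h *: (@id R - cst x0)); last first.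
    by apply/funext => y.
  by apply: is_derive_eq; rewrite subr0 /GRing.scale/= mulr1.
have d2 := @is_derive1_comp R (@atan R) (fun y => h * (y - x0)) x _ _ (is_derive1_atan _) d1.
rewrite [X in is_derive _ _ X](_ : _ = h^-1 *: (atan \o (fun y => h * (y - x0)))); last first.
  by apply/funext => y.
apply: is_derive_eq; rewrite /GRing.scale/= /cauchy_kernel.
by field; rewrite hn gt_eqF// cauchy_kernel_den_gt0.
Qed.

Lemma continuous_cauchy_kernel h x0 : continuous (cauchy_kernel h x0).
Proof.
move=> x; apply: cvgV; first by rewrite gt_eqF// cauchy_kernel_den_gt0.
apply: cvgD; first exact: cvg_cst.
apply: (@cvgM _ _ _ _ (fun y : R => h * (y - x0)) (fun y => h * (y - x0)));
  (apply: cvgM; [exact: cvg_cst|apply: cvgB; [exact: cvg_id|exact: cvg_cst]]).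
Qed.

(** The primitive [h^-1 * atan (h * (x - x0))] grows by at most [pi / h] on each of the intervals
    [F k], which exhaust the line. *)
Lemma integral_cauchy_kernel (h x0 : R) : 0 < h ->
  (\int[@lebesgue_measure R]_x (cauchy_kernel h x0 x)%:E <= (pi / h)%:E)%E.
Proof.
move=> h0.
pose F (k : nat) : set (measurableTypeR R) := `[- k.+1%:R, k.+1%:R]%classic.
have mc : measurable_fun setT (cauchy_kernel h x0).
  by apply: continuous_measurable_fun; exact: continuous_cauchy_kernel.
have FT : \bigcup_i F i = setT.
  apply/seteqP; split => // x _; exists (Num.truncn `|x|) => //=.
  by rewrite /F /= in_itv/= -ler_norml; apply/ltW/truncnS_gt.
have := @ge0_nondecreasing_set_cvg_integral _ (measurableTypeR R) R F
  (fun x => (cauchy_kernel h x0 x)%:E) lebesgue_measure.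
rewrite FT => /(_ _ _ _ _)/cvge_to_le; apply.
- apply/nondecreasing_seqP => k; rewrite subsetEset => x; rewrite /F /= !in_itv/= -!ler_norml.
  by move=> /le_trans; apply; rewrite ler_nat.
- by move=> i; exact: measurable_itv.
- by move=> i; apply/measurable_EFinP; apply: measurable_funS mc.
- by move=> i x _; rewrite lee_fin cauchy_kernel_ge0.
apply: nearW => k.
have k0 : - k.+1%:R < k.+1%:R :> R by rewrite gt0_cp.
have cA : continuous (fun y => h^-1 * atan (h * (y - x0))).
  move=> x; apply/differentiable_continuous/derivable1_diffP.
  by case: (is_derive_atan_scale x0 x h0).
rewrite (@continuous_FTC2 _ _ (fun y => h^-1 * atan (h * (y - x0))) _ _ k0).
- rewrite -EFinB lee_fin -mulrBr mulrC ler_pM2r ?invr_gt0//.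
  have := atan_ltpi2 (h * (k.+1%:R - x0)); have := atan_gtNpi2 (h * (- k.+1%:R - x0)).
  by move=> *; lra.
- by apply: continuous_subspaceT; exact: continuous_cauchy_kernel.
- split => [x _||].
  + by case: (is_derive_atan_scale x0 x h0).
  + exact: cvg_at_right_filter (cA _).
  + exact: cvg_at_left_filter (cA _).
- by move=> x _; rewrite derive1E; have [_ ->] := is_derive_atan_scale x0 x h0.
Qed.

Lemma normc_nneg (z : R[i]) : 0 <= normc z.
Proof. by case: z => a b; exact: sqrtr_ge0. Qed.

(* A root nearest to [w] works, as p' / p is the sum of the 1 / (w - z). *)
Lemma root_ratio (rs : seq R[i]) (w : R[i]) : rs != [::] ->
  let p := \prod_(z <- rs) ('X - z%:P) in
  exists2 z, z \in rs &
    normc (p^`().[w]) * normc (w - z) <= (size rs)%:R * normc p.[w].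
Proof.
elim: rs => // a rs IH _ /=.
rewrite big_cons derivM derivXsubC mul1r !hornerE.
set q := \prod_(z <- rs) _ in IH *.
have [rs0|rs0] := eqVneq rs [::].
  exists a; first by rewrite mem_head.
  rewrite /q rs0 big_nil -polyC1 derivC !hornerE /=.
  by rewrite expr1n expr0n addr0 sqrtr1 mul1r.
have [z zrs zle] := IH rs0.
have nD := @le_normcD R q.[w] ((w - a) * q^`().[w]).
have n0 := normc_nneg.
rewrite normcM in nD; rewrite normcM.
(* The nearer of [z] and [a] is kept: its distance to [w] is at most [normc (w - a)], which handles
   the term [q.[w]], and at most [normc (w - z)], which lets the induction hypothesis handle the
   other term. *)
have [za|az] := leP (normc (w - z)) (normc (w - a)).
  exists z; first by rewrite inE zrs orbT.
  apply: le_trans (ler_wpM2r (n0 _) nD) _.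
  rewrite mulrDl -natr1 mulrDl mul1r [leRHS]addrC; apply: lerD.
    by rewrite mulrC ler_wpM2r.
  rewrite -mulrA [leRHS]mulrCA; apply: ler_wpM2l => //.
exists a; first exact: mem_head.
apply: le_trans (ler_wpM2r (n0 _) nD) _.
rewrite mulrDl -natr1 mulrDl mul1r [leRHS]addrC; apply: lerD; first by rewrite mulrC.
rewrite -mulrA [leRHS]mulrCA; apply: ler_wpM2l => //.
apply: le_trans zle; apply: ler_wpM2l => //; exact: ltW.
Qed.

(** The square of [a / b], tamed so as to stay between 0 and 1 even where [b] vanishes; at the
    origin, division by 0 gives the value 0. *)
Definition ratio (a b : R) : R := a ^+ 2 / (a ^+ 2 + b ^+ 2).

Lemma ratio_ge0 a b : 0 <= ratio a b.
Proof. by rewrite divr_ge0// ?addr_ge0 ?sqr_ge0. Qed.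

Lemma ratioZ c a b : c != 0 -> ratio (c * a) (c * b) = ratio a b.
Proof. by move=> c0; rewrite /ratio !exprMn -mulrDr -mulf_div divff ?mul1r// sqrf_eq0. Qed.

Lemma ratio0l b : ratio 0 b = 0.
Proof. by rewrite /ratio expr0n mul0r. Qed.

(** Since [1 <= D], squaring gives [a^2 (1 + r^2) <= D^2 (a^2 + b^2)]. *)
Lemma ratio_le (a b r D : R) : 0 <= a -> 0 <= b -> 0 <= r -> 1 <= D ->
  a * r <= D * b -> ratio a b <= D ^+ 2 / (1 + r ^+ 2).
Proof.
move=> a0 b0 r0 D1 h; have D2 : 1 <= D ^+ 2 by rewrite expr_ge1//; lra.
have [->|an0] := eqVneq a 0; first by rewrite ratio0l divr_ge0// ?addr_ge0 ?sqr_ge0.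
have ap : 0 < a by rewrite lt_neqAle eq_sym an0.
have den : 0 < a ^+ 2 + b ^+ 2 by rewrite ltr_pwDl ?sqr_ge0 ?exprn_gt0.
have den2 : 0 < 1 + r ^+ 2 by rewrite ltr_pwDl ?sqr_ge0.
rewrite /ratio ler_pdivrMr// mulrAC ler_pdivlMr//.
have : (a * r) ^+ 2 <= (D * b) ^+ 2 by rewrite ler_sqr ?nnegrE ?mulr_ge0//; lra.
rewrite !exprMn; have : a ^+ 2 * 1 <= a ^+ 2 * D ^+ 2 by rewrite ler_wpM2l ?sqr_ge0.
by lra.
Qed.

(** The root given by [root_ratio] varies with the point, hence the sum over all roots. The ratio is
    squared for the sake of integrability in the plane: with [X] and [Y] the squared scaled offsets,
    [(1 + X) (1 + Y) <= (1 + X + Y)^2] yields a product of one-variable kernels. *)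
Lemma poly_ratio_pointwise (rs : seq R[i]) (c : R[i]) (h x y : R) :
  0 < h -> rs != [::] -> c != 0 ->
  let p := c *: \prod_(z <- rs) ('X - z%:P) in
  ratio (normc p^`().[x +i* y]) (h * normc p.[x +i* y]) ^+ 2 <=
  \sum_(z <- rs) (size rs)%:R ^+ 4 *
    (cauchy_kernel h (complex.Im z) y * cauchy_kernel h (complex.Re z) x).
Proof.
move=> h0 rs0 c0; cbv zeta; set p := c *: _; have [z zrs] := root_ratio (x +i* y) rs0.
rewrite /p derivZ !hornerZ; set P := \prod_(z <- rs) _ => zle.
rewrite !normcM [h * _]mulrCA ratioZ; last first.
  by apply: contra_neq c0; exact: eq0_normc.
have n0 := normc_nneg.
have rs1 : 1 <= (size rs)%:R :> R by rewrite ler1n lt0n size_eq0.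
have := @ratio_le (normc P^`().[x +i* y]) (h * normc P.[x +i* y])
   (h * normc (x +i* y - z)) (size rs)%:R.
rewrite !mulr_ge0 ?n0 ?(ltW h0)// => /(_ isT isT isT rs1).
rewrite [_ * (h * _)]mulrCA [_ * (h * _)]mulrCA ler_pM2l// => /(_ zle) rle.
rewrite (big_rem z)//= -[leLHS]addr0; apply: lerD; last first.
  apply: sumr_ge0 => u _; rewrite mulr_ge0 ?exprn_ge0//.
  by rewrite mulr_ge0// cauchy_kernel_ge0.
have d0 : 0 < 1 + (h * normc (x +i* y - z)) ^+ 2 by rewrite ltr_pwDl// sqr_ge0.
apply: (@le_trans _ _ (((size rs)%:R ^+ 2 / (1 + (h * normc (x +i* y - z)) ^+ 2)) ^+ 2)).
  by rewrite ler_sqr// ?nnegrE ?ratio_ge0// divr_ge0// ?sqr_ge0 ?ltW.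
rewrite expr_div_n -exprM; apply: ler_wpM2l; first exact: exprn_ge0.
rewrite /cauchy_kernel -invfM lef_pV2 ?posrE ?mulr_gt0 ?cauchy_kernel_den_gt0 ?exprn_gt0//.
have -> : (h * normc (x +i* y - z)) ^+ 2 =
   (h * (x - complex.Re z)) ^+ 2 + (h * (y - complex.Im z)) ^+ 2.
  case: z {zrs zle rle d0} => a b /=.
  by rewrite exprMn sqr_sqrtr ?addr_ge0 ?sqr_ge0// mulrDr !exprMn.
set X := (h * (x - _)) ^+ 2; set Y := (h * (y - _)) ^+ 2.
have X0 : 0 <= X by exact: sqr_ge0.
have Y0 : 0 <= Y by exact: sqr_ge0.
by nra.
Qed.

Local Open Scope ereal_scope.

Lemma cauchy_kernel_sum_integral (rs : seq R[i]) (c h : R) : (0 < h)%R -> (0 <= c)%R ->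
  \int[@lebesgue_measure R]_y \int[@lebesgue_measure R]_x
    (\sum_(z <- rs) c *
      (cauchy_kernel h (complex.Im z) y * cauchy_kernel h (complex.Re z) x))%R%:E
  <= ((size rs)%:R * c * (pi / h) ^+ 2)%:E.
Proof.
move=> h0 c0.
have mk x0 : measurable_fun setT (fun x : measurableTypeR R => (cauchy_kernel h x0 x)%:E).
  apply/measurable_EFinP.
  by apply: continuous_measurable_fun; exact: continuous_cauchy_kernel.
have k0 x0 x : 0 <= (cauchy_kernel h x0 x)%:E by rewrite lee_fin cauchy_kernel_ge0.
have ph : (0 <= pi / h)%R by rewrite divr_ge0 ?pi_ge0// ltW.
have I1 y : \int[@lebesgue_measure R]_x
    (\sum_(z <- rs) c *
      (cauchy_kernel h (complex.Im z) y * cauchy_kernel h (complex.Re z) x))%R%:E <=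
   \sum_(z <- rs) (c * (pi / h))%:E * (cauchy_kernel h (complex.Im z) y)%:E.
  under eq_integral do rewrite -sumEFin.
  rewrite ge0_integral_sum//.
  - apply: lee_sum => z _.
    under eq_integral do rewrite mulrA EFinM.
    rewrite ge0_integralZl//; last first.
      by rewrite lee_fin mulr_ge0// cauchy_kernel_ge0.
    rewrite -EFinM mulrAC [leRHS]EFinM; apply: lee_wpmul2l; last exact: integral_cauchy_kernel.
    by rewrite lee_fin mulr_ge0// cauchy_kernel_ge0.
  - move=> z; under eq_fun do rewrite mulrA EFinM.
    by apply: measurable_funeM.
  - by move=> z x _; rewrite lee_fin !mulr_ge0// cauchy_kernel_ge0.
apply: le_trans.
  apply: (@ge0_le_integral_nomeas _ _ lebesgue_measure _ _ _ I1).
  move=> y; apply: integral_ge0 => x _; rewrite lee_fin.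
  by apply: sumr_ge0 => z _; rewrite !mulr_ge0// cauchy_kernel_ge0.
rewrite ge0_integral_sum//.
- apply: (@le_trans _ _ (\sum_(z <- rs) (c * (pi / h) * (pi / h))%:E)).
    apply: lee_sum => z _; rewrite ge0_integralZl//; last by rewrite lee_fin mulr_ge0.
    rewrite [leRHS]EFinM; apply: lee_wpmul2l; first by rewrite lee_fin mulr_ge0.
    exact: integral_cauchy_kernel.
  by rewrite sumEFin big_const_seq count_predT iter_addr_0 lee_fin -[leLHS]mulr_natl
    expr2 !mulrA lexx.
- by move=> z; apply: measurable_funeM.
- by move=> z x _; apply: mule_ge0 => //; rewrite lee_fin mulr_ge0.
Qed.

(** If the derivative is zero, so is the integrand; otherwise [p] splits over a nonempty list of
    roots. Of the factor [D ^ 5], four powers come from the pointwise bound and one from the number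
    of roots. *)
Lemma poly_ratio_integral (p : {poly R[i]}) (D : nat) (h : R) :
  (0 < h)%R -> (size p <= D.+1)%N ->
  \int[@lebesgue_measure R]_y \int[@lebesgue_measure R]_x
    (ratio (normc p^`().[x +i* y]) (h * normc p.[x +i* y]) ^+ 2)%R%:E
   <= (D%:R ^+ 5 * (pi / h) ^+ 2)%:E.
Proof.
move=> h0 sp.
have ph : (0 <= pi / h)%R by rewrite divr_ge0 ?pi_ge0// ltW.
have [p'0|p'n0] := eqVneq p^`()%R 0%R.
  rewrite integral0_eq => [|y _].
    by rewrite lee_fin; apply: mulr_ge0; apply: exprn_ge0.
  by apply: integral0_eq => x _; rewrite p'0 horner0 normc0 ratio0l expr0n.
have pn0 : p != 0%R by apply: contra_neq p'n0 => ->; exact: deriv0.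
have [rs pE] := closed_field_poly_normal p.
have c0 : lead_coef p != 0%R by rewrite lead_coef_eq0.
have srs : (size rs <= D)%N.
  by move: sp; rewrite pE size_scale// size_prod_XsubC ltnS.
have rs0 : rs != [::].
  by apply: contra_neq p'n0 => rs0; rewrite pE rs0 big_nil alg_polyC derivC.
apply: le_trans.
  apply: (@ge0_le_integral_nomeas _ _ lebesgue_measure _ (fun y => \int[@lebesgue_measure R]_x
    (\sum_(z <- rs) (size rs)%:R ^+ 4 *
      (cauchy_kernel h (complex.Im z) y * cauchy_kernel h (complex.Re z) x))%R%:E)).
  - by move=> y; apply: integral_ge0 => x _; rewrite lee_fin sqr_ge0.
  - move=> y; apply: ge0_le_integral_nomeas => x; first by rewrite lee_fin sqr_ge0.
    by rewrite lee_fin {1 2}pE; exact: poly_ratio_pointwise.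
apply: le_trans (cauchy_kernel_sum_integral _ h0 _) _; first exact: exprn_ge0.
rewrite lee_fin -exprS ler_wpM2r ?exprn_ge0// ler_pXn2r ?nnegrE ?ler0n// ler_nat.
exact: srs.
Qed.

End root_estimates.

(** * Complex polynomials on R^{2n} *)

Section polynomial_calculus.
Context {R : realType}.

(** In [P p s] the number [s] stands for a degree bound: it adds up under products and may be
    raised. Expanding [p] into monomials, and these into variables, reaches every polynomial. *)
Lemma mpoly_degree_ind (K : comNzRingType) n (P : mpoly n K -> nat -> Prop) :
  (forall c, P (mpolyC n c) 0%N) ->
  (forall i, P (mpolyX K (mnm1 i)) 1%N) ->
  (forall p q s, P p s -> P q s -> P (p + q) s) ->
  (forall p q s t, P p s -> P q t -> P (p * q) (s + t)%N) ->
  (forall p s t, P p s -> (s <= t)%N -> P p t) ->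
  forall p D, (mmeasure mdeg p <= D.+1)%N -> P p D.
Proof.
move=> PC PX PD PM Pw p D pD.
rewrite (mpolyE p) big_seq; apply: (big_ind (fun q => P q D)).
- by rewrite -(mpolyC0 n K); exact: Pw (PC 0) _.
- by move=> x y; exact: PD.
move=> m mp; rewrite -mul_mpolyC -[D]add0n; apply: (PM) => //.
have mD : (mdeg m <= D)%N by rewrite -ltnS (leq_trans (msize_mdeg_lt mp)).
apply: (Pw) mD; rewrite mpolyXE_id mdegE.
apply: (big_ind2 (fun q s => P q s)) => [||i _].
- by rewrite -(mpolyC1 n K).
- by move=> x s y t; exact: PM.
elim: (m i) => [|k IH]; first by rewrite expr0 -(mpolyC1 n K).
by rewrite exprS -add1n; exact: PM.
Qed.

Section evaluation.
Variable n : nat.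
Implicit Types (f g : mpoly n R[i]) (z : 'rV[R[i]]_n) (x : 'rV[R]_(n + n)).

Lemma evalCD f g z : evalC (f + g) z = evalC f z + evalC g z.
Proof. exact: mevalD. Qed.

Lemma evalCM f g z : evalC (f * g) z = evalC f z * evalC g z.
Proof. exact: mevalM. Qed.

Lemma evalCC c z : evalC (mpolyC n c) z = c.
Proof. exact: mevalC. Qed.

Lemma evalCX k z : evalC (mpolyX R[i] (mnm1 k)) z = z 0 k.
Proof.
rewrite /evalC mevalX (bigD1 k)//= mnm1E eqxx expr1 big1 ?mulr1// => j jk.
by rewrite mnm1E eq_sym (negbTE jk) expr0.
Qed.

Lemma cReM (a b : R[i]) : complex.Re (a * b) =
  complex.Re a * complex.Re b - complex.Im a * complex.Im b.
Proof. by case: a; case: b. Qed.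

Lemma cImM (a b : R[i]) : complex.Im (a * b) =
  complex.Re a * complex.Im b + complex.Im a * complex.Re b.
Proof. by case: a => a a'; case: b => b b' /=. Qed.

Lemma cReD (a b : R[i]) : complex.Re (a + b) = complex.Re a + complex.Re b.
Proof. by case: a; case: b. Qed.

Lemma cImD (a b : R[i]) : complex.Im (a + b) = complex.Im a + complex.Im b.
Proof. by case: a; case: b. Qed.

Definition reC f x : R := complex.Re (evalC f (toC x)).
Definition imC f x : R := complex.Im (evalC f (toC x)).

Lemma reCD f g : reC (f + g) = reC f + reC g.
Proof. by apply/funext => x; rewrite /reC evalCD cReD. Qed.

Lemma imCD f g : imC (f + g) = imC f + imC g.
Proof. by apply/funext => x; rewrite /imC evalCD cImD. Qed.

Lemma reCM f g : reC (f * g) = reC f * reC g - imC f * imC g.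
Proof. by apply/funext => x; rewrite /reC evalCM cReM. Qed.

Lemma imCM f g : imC (f * g) = reC f * imC g + imC f * reC g.
Proof. by apply/funext => x; rewrite /imC evalCM cImM. Qed.

Lemma reCC c : reC (mpolyC n c) = cst (complex.Re c).
Proof. by apply/funext => x; rewrite /reC evalCC. Qed.

Lemma imCC c : imC (mpolyC n c) = cst (complex.Im c).
Proof. by apply/funext => x; rewrite /imC evalCC. Qed.

Lemma reCX k : reC (mpolyX R[i] (mnm1 k)) = (fun x => x 0 (lshift n k)).
Proof. by apply/funext => x; rewrite /reC evalCX mxE. Qed.

Lemma imCX k : imC (mpolyX R[i] (mnm1 k)) = (fun x => x 0 (rshift n k)).
Proof. by apply/funext => x; rewrite /imC evalCX mxE. Qed.

Lemma continuous_mulr m (F G : 'rV[R]_m -> R) :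
  continuous F -> continuous G -> continuous (F * G).
Proof. by move=> cF cG x; apply: continuousM; [exact: cF|exact: cG]. Qed.

Lemma continuous_evalC f : continuous (reC f) /\ continuous (imC f).
Proof.
apply: (mpoly_degree_ind (P := fun f _ => continuous (reC f) /\ continuous (imC f))
  _ _ _ _ _ (leqnSn _)).
- by move=> c; rewrite reCC imCC; split; exact: cst_continuous.
- by move=> k; rewrite reCX imCX; split; exact: coord_continuous.
- move=> p q _ [cp cp'] [cq cq']; rewrite reCD imCD.
  by split=> x; [exact: cvgD (cp x) (cq x)|exact: cvgD (cp' x) (cq' x)].
- move=> p q _ _ [cp cp'] [cq cq']; rewrite reCM imCM.
  have c1 := continuous_mulr cp cq; have c2 := continuous_mulr cp' cq'.
  have c3 := continuous_mulr cp cq'; have c4 := continuous_mulr cp' cq.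
  by split=> x; [exact: cvgB (c1 x) (c2 x)|exact: cvgD (c3 x) (c4 x)].
- by move=> p s t.
Qed.

(* The real coordinate [u] of R^{2n} is the real or imaginary part of the
   complex coordinate [cvar u]; moving along [u] moves the latter in the
   direction [cdir u]. *)
Definition cvar (u : 'I_(n + n)) : 'I_n :=
  match fintype.split u with inl k => k | inr k => k end.

Definition cdir (u : 'I_(n + n)) : R[i] :=
  match fintype.split u with inl _ => 1 | inr _ => 'i end.

Lemma is_derive_coord m (x : 'rV[R]_m) (u j : 'I_m) :
  is_derive x (delta_mx 0 u) (fun y : 'rV[R]_m => y 0 j) (j == u)%:R.
Proof.
have E : (fun h : R => h^-1 *: (((fun y : 'rV[R]_m => y 0 j) (h *: delta_mx 0 u + x)) -
      (fun y : 'rV[R]_m => y 0 j) x)) @ 0^' --> ((j == u)%:R : R).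
  apply: (@cvg_trans _ (((fun=> (j == u)%:R) : R -> R) @ 0^')); last exact: cvg_cst.
  apply: near_eq_cvg; near=> h.
  have hn : h != 0 by near: h; exact: nbhs_dnbhs_neq.
  by rewrite !mxE eqxx /= addrK /GRing.scale/= mulKf.
split; first by apply/cvg_ex; exists (j == u)%:R.
exact: cvg_lim E.
Unshelve. all: by end_near. Qed.

(** Along [u] the complex variable [cvar u] moves with velocity [cdir u], so the two conjuncts
    amount to the Cauchy-Riemann equations. They are preserved by sums and, by the product rule, by
    products. *)
Lemma is_derive_evalC f (u : 'I_(n + n)) x :
  is_derive x (delta_mx 0 u) (reC f)
    (complex.Re (cdir u * evalC (mderiv (cvar u) f) (toC x))) /\
  is_derive x (delta_mx 0 u) (imC f)
    (complex.Im (cdir u * evalC (mderiv (cvar u) f) (toC x))).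
Proof.
apply: (mpoly_degree_ind (P := fun f _ =>
  is_derive x (delta_mx 0 u) (reC f)
    (complex.Re (cdir u * evalC (mderiv (cvar u) f) (toC x))) /\
  is_derive x (delta_mx 0 u) (imC f)
    (complex.Im (cdir u * evalC (mderiv (cvar u) f) (toC x)))) _ _ _ _ _ (leqnSn _)).
- move=> c; rewrite reCC imCC mderivC -(mpolyC0 n) evalCC mulr0.
  by split; exact: is_derive_cst.
- move=> k; rewrite reCX imCX.
  have -> : evalC (mderiv (cvar u) (mpolyX R[i] (mnm1 k))) (toC x) = (k == cvar u)%:R.
    rewrite mderivX mnm1E; case: eqP => [->|_]; last first.
      by rewrite scale0r -(mpolyC0 n) evalCC.
    rewrite scale1r (_ : mnm_sub _ _ = mnm0); first by rewrite mpolyX0 -(mpolyC1 n) evalCC.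
    by apply/mnmP => j; rewrite mnmBE mnm0E subnn.
  have := is_derive_coord x u (lshift n k); have := is_derive_coord x u (rshift n k).
  rewrite /cvar /cdir; case: (fintype.split_ordP u) => l ->.
    rewrite eq_rlshift eq_lshift mul1r => d1 d2.
    by split; [case: eqP d2 => _ d2; exact: d2|case: eqP d2 => _ d2; exact: d1].
  rewrite eq_lrshift eq_rshift => d1 d2.
  by split; case: eqP d1 => _ d1; rewrite ?mulr1 ?mulr0 //; exact: d2.
- move=> p q _ [dp dp'] [dq dq']; rewrite reCD imCD mderivD evalCD mulrDr cReD cImD.
  by split; exact: is_deriveD.
- move=> p q _ _ [dp dp'] [dq dq']; rewrite reCM imCM mderivM evalCD !evalCM mulrDr.
  rewrite mulrA [cdir u * (_ * _)]mulrCA.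
  split.
    by apply: is_derive_eq; rewrite cReD !cReM /GRing.scale/= /reC /imC; ring.
  by apply: is_derive_eq; rewrite cImD !cImM /GRing.scale/= /reC /imC; ring.
- by move=> p s t.
Qed.

Definition subst z (k : 'I_n) (w : R[i]) : 'rV[R[i]]_n :=
  \row_j if j == k then w else z 0 j.

(** Makes the one-variable root estimates available on complex lines parallel to an axis. *)
Lemma evalC_slice f D k z : (mmeasure mdeg f <= D.+1)%N ->
  exists2 p : {poly R[i]}, (size p <= D.+1)%N &
    forall w, p.[w] = evalC f (subst z k w) /\
      p^`().[w] = evalC (mderiv k f) (subst z k w).
Proof.
apply: (mpoly_degree_ind (P := fun f D =>
  exists2 p : {poly R[i]}, (size p <= D.+1)%N &
    forall w, p.[w] = evalC f (subst z k w) /\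
      p^`().[w] = evalC (mderiv k f) (subst z k w))).
- move=> c; exists c%:P; first exact: size_polyC_leq1.
  by move=> w; rewrite derivC mderivC -(mpolyC0 n) !evalCC !hornerE.
- move=> j; exists (if j == k then 'X else (z 0 j)%:P).
    by case: ifP; rewrite ?size_polyX// (leq_trans (size_polyC_leq1 _)).
  move=> w; rewrite evalCX mxE mderivX mnm1E.
  case: eqP => [->|_]; last by rewrite derivC scale0r -(mpolyC0 n) evalCC !hornerE.
  rewrite derivX scale1r (_ : mnm_sub _ _ = mnm0).
    by rewrite mpolyX0 -(mpolyC1 n) evalCC !hornerE.
  by apply/mnmP => l; rewrite mnmBE mnm0E subnn.
- move=> f1 f2 s [p sp pP] [q sq qP]; exists (p + q).
    by rewrite (leq_trans (size_polyD _ _))// geq_max sp.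
  move=> w; have [p1 p2] := pP w; have [q1 q2] := qP w.
  by rewrite derivD mderivD !hornerD !evalCD p1 p2 q1 q2.
- move=> f1 f2 s t [p sp pP] [q sq qP]; exists (p * q).
    rewrite (leq_trans (size_polyMleq _ _))// -subn1 leq_subLR add1n.
    by rewrite (leq_trans (leq_add sp sq))// addSn addnS.
  move=> w; have [p1 p2] := pP w; have [q1 q2] := qP w.
  by rewrite derivM mderivM !hornerE !evalCD !evalCM p1 p2 q1 q2.
- by move=> f1 s t [p sp pP] st; exists p => //; rewrite (leq_trans sp).
Qed.

Lemma toC_upd (t : (n + n).-tuple (measurableTypeR R)) k (x y : R) :
  toC (rowt (upd (upd t (rshift n k) y) (lshift n k) x)) =
  subst (toC (rowt t)) k (x +i* y).
Proof.
apply/rowP => j; rewrite !mxE !tnth_mktuple eq_lshift eq_rlshift eq_lrshift eq_rshift.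
by case: (j == k).
Qed.

Lemma sqr_normcE (a : R[i]) : normc a ^+ 2 = complex.Re a ^+ 2 + complex.Im a ^+ 2.
Proof. by case: a => a b /=; rewrite sqr_sqrtr// addr_ge0// sqr_ge0. Qed.

Lemma continuous_sqr_norm f : continuous (fun x => normc (evalC f (toC x)) ^+ 2).
Proof.
have [cr ci] := continuous_evalC f.
have -> : (fun x => normc (evalC f (toC x)) ^+ 2) = reC f * reC f + imC f * imC f.
  by apply/funext => x; rewrite sqr_normcE !expr2.
have c1 := continuous_mulr cr cr; have c2 := continuous_mulr ci ci.
by move=> x; exact: cvgD (c1 x) (c2 x).
Qed.

Lemma measurable_ratio f g (h : R) :
  measurable_fun setT (fun t : (n + n).-tuple (measurableTypeR R) =>
    ratio (normc (evalC g (toC (rowt t)))) (h * normc (evalC f (toC (rowt t))))).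
Proof.
have mN p := continuous_rowt_measurable (@continuous_sqr_norm p).
rewrite /ratio; under eq_fun do rewrite exprMn.
pose den (t : (n + n).-tuple (measurableTypeR R)) := normc (evalC g (toC (rowt t))) ^+ 2 +
  h ^+ 2 * normc (evalC f (toC (rowt t))) ^+ 2.
have mden : measurable_fun setT den.
  by apply: measurable_funD => //; apply: measurable_funM => //; exact: mN.
have den0 t : 0 <= den t.
  by apply: addr_ge0; [exact: sqr_ge0|rewrite mulr_ge0 ?sqr_ge0].
(* The denominator may vanish; its inverse is rewritten as the power -1, which is measurable on the
   whole line. *)
under eq_fun => t do rewrite -/(den t) -(powR_inv1 (den0 t)).
apply: measurable_funM; first exact: mN.
exact: (measurableT_comp (measurable_powR (-1)) mden).
Qed.

(** The two real coordinates of the [k]-th complex variable are integrated first: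
    [poly_ratio_integral] bounds that double integral uniformly in the other coordinates. *)
Lemma ratio_box_integral f D k (h B : R) : 0 < h -> 1 <= B ->
  (mmeasure mdeg f <= D.+1)%N ->
  (\int[lebesgue_tuple (n + n)]_(t in box B)
    (ratio (normc (evalC (mderiv k f) (toC (rowt t))))
      (h * normc (evalC f (toC (rowt t)))) ^+ 2)%:E
  <= (D%:R ^+ 5 * (pi / h) ^+ 2)%:E * ((2 * B) ^+ (n + n))%:E)%E.
Proof.
move=> h0 B1 fD.
apply: (@ge0_integral_box_le _ _ (lshift n k) (rshift n k)) => //.
- by rewrite eq_lrshift.
- rewrite lee_fin; apply: mulr_ge0; apply: exprn_ge0 => //.
  by apply: divr_ge0; [exact: pi_ge0|exact: ltW].
- apply/measurable_EFinP; apply: measurable_funX; exact: measurable_ratio.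
- by move=> t; rewrite lee_fin sqr_ge0.
move=> t; have [p sp pP] := evalC_slice k (toC (rowt t)) fD.
under eq_integral => y _ do under eq_integral => x _ do
  rewrite toC_upd -(pP _).1 -(pP _).2.
exact: poly_ratio_integral.
Qed.

(** For a monomial [a] of top degree in [f], [mderivm a] kills every other monomial and leaves the
    coefficient of [a] times its multi-factorial. *)
Lemma mderivm_top f d : has_degree d f ->
  exists2 a : multinom n, mdeg a = d & exists2 c : R[i], c != 0 &
    mderivm a f = mpolyC n c.
Proof.
move=> fd.
have [a af ad] : exists2 a, a \in msupp f & mdeg a = d.
  apply: contrapT => na; have : (mmeasure mdeg f <= d)%N.
    rewrite mmeasureE; apply/bigmax_leqP_seq => a af _.
    rewrite ltn_neqAle; apply/andP; split.
      by apply/eqP => ad; apply: na; exists a.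
    by rewrite -ltnS -fd; exact: msize_mdeg_lt.
  by rewrite fd ltnn.
exists a => //; exists (mcoeff a f *+ \prod_(i < n) (a i) ^_ (a i)).
  rewrite mulrn_eq0 negb_or -mcoeff_msupp af andbT -lt0n.
  by rewrite prodn_gt0// => i; rewrite ffactnn fact_gt0.
apply/mpolyP => m; rewrite mcoeff_mderivm mcoeffC.
have [->|m0] := eqVneq m mnm0.
  by rewrite mulr1 addm0.
rewrite mulr0 memN_msupp_eq0 ?mul0rn//; apply: msize_mdeg_ge.
by rewrite fd mdegD ad -addn1 leq_add2l lt0n mdeg_eq0.
Qed.

End evaluation.
End polynomial_calculus.

(** * Normalized jets and symbols *)

Section directional_rules.
Context {R : realType} {U : normedModType R}.
Implicit Types (x v : U) (F G : U -> R).

Lemma der_add F G x v a b : is_derive x v F a -> is_derive x v G b ->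
  is_derive x v (fun y => F y + G y) (a + b).
Proof. exact: is_deriveD. Qed.

Lemma der_mul F G x v a b : is_derive x v F a -> is_derive x v G b ->
  is_derive x v (fun y => F y * G y) (F x * b + G x * a).
Proof. by move=> dF dG; apply: is_derive_eq (is_deriveM dF dG) _. Qed.

Lemma der_cst (c : R) x v : is_derive x v (fun=> c) 0.
Proof. exact: is_derive_cst. Qed.

Lemma der_sum I (r : seq I) (P : pred I) (F : I -> U -> R) (dF : I -> R) x v :
  (forall i, P i -> is_derive x v (F i) (dF i)) ->
  is_derive x v (fun y => \sum_(i <- r | P i) F i y) (\sum_(i <- r | P i) dF i).
Proof.
move=> dFP; elim: r => [|i r IH].
  by under eq_fun do rewrite big_nil; rewrite big_nil; exact: der_cst.
rewrite big_cons; under eq_fun do rewrite big_cons.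
by case: ifP => // Pi; apply: der_add => //; exact: dFP.
Qed.

(** Only the derivative along [v] is given, so the one-variable chain rule is applied on the line
    [t *: v + x]. *)
Lemma der_comp F (g : R -> R) x v a b : is_derive x v F a -> is_derive (F x) 1 g b ->
  is_derive x v (fun y => g (F y)) (a * b).
Proof.
move=> dF dg.
have line (H : U -> R) l : is_derive x v H l <->
    is_derive (0 : R) 1 (fun t : R => H (t *: v + x)) l.
  have E : (fun h : R => h^-1 *: ((fun t : R => H (t *: v + x)) (h *: 1 + 0) -
        (fun t : R => H (t *: v + x)) 0)) =
      (fun h : R => h^-1 *: (H (h *: v + x) - H x)).
    by apply/funext => h; rewrite scale0r add0r addr0 /GRing.scale/= mulr1.
  split => -[d1 d2]; split.
  - by rewrite /derivable E.
  - by rewrite -d2 /derive E.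
  - by move: d1; rewrite /derivable E.
  - by rewrite -d2 /derive E.
apply/line; have dF' := (line F a).1 dF.
have dg' : is_derive (F (0 *: v + x)) 1 g b by rewrite scale0r add0r.
have := @is_derive1_comp _ g (fun t : R => F (t *: v + x)) 0 _ _ dg' dF'.
by rewrite /GRing.scale/= mulrC.
Qed.

Lemma continuous_sumr I (r : seq I) (P : pred I) (F : I -> U -> R) :
  (forall i, continuous (F i)) -> continuous (fun y => \sum_(i <- r | P i) F i y).
Proof.
move=> cF; elim: r => [|i r IH].
  by under eq_fun do rewrite big_nil; exact: cst_continuous.
under eq_fun do rewrite big_cons.
case Pi: (P i) => // x.
by apply: cvgD; [exact: cF|exact: IH].
Qed.

End directional_rules.

(** * Jets, symbols and their weights *)

Section symbols.
Context {R : realType}.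
Variables n d : nat.
Local Notation pt := ('rV[R]_(n + n)).
Local Notation family := (mpoly n R[i] -> R -> pt -> R).
Implicit Types (f : mpoly n R[i]) (h : R) (x : pt) (a : multinom n) (u : 'I_(n + n)).

Definition jet (b : bool) a : family := fun f h x =>
  h^-1 ^+ mdeg a * (if b then imC (mderivm a f) x else reC (mderivm a f) x).

Definition jetN a : family := fun f h x => jet false a f h x ^+ 2 + jet true a f h x ^+ 2.

(* The two sums are the squared gradient, divided by [h ^ 2], and the terms of
   order at least 2. *)
Definition jetQ : family := fun f h x =>
  \sum_(k < n) jetN (mnm1 k) f h x +
  \sum_(a : bmultinom n d.+1 | (1 < mdeg a)%N) jetN a f h x.

Definition jetq : family := fun f h x => (Num.sqrt (jetQ f h x))^-1.

(* [h * djet u b a] is the partial derivative of [jet b a] along [u], by the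
   Cauchy-Riemann equations. *)
Definition djet u (b : bool) a : family := fun f h x =>
  let a' := mnm_add a (mnm1 (cvar u)) in
  match fintype.split u with
  | inl _ => jet b a' f h x
  | inr _ => if b then jet false a' f h x else - jet true a' f h x
  end.

(** With [0 < d] the derivatives of order [d] enter [jetQ]; one of them is a nonzero constant,
    whence [jetQ_gt0] at every point. *)
Definition admissible f h := [/\ (0 < d)%N, 0 < h & has_degree d f].

Lemma jetN_ge0 a f h x : 0 <= jetN a f h x.
Proof. by rewrite addr_ge0 ?sqr_ge0. Qed.

Lemma jetNE a f h x : jetN a f h x =
  (h^-1 ^+ mdeg a * normc (evalC (mderivm a f) (toC x))) ^+ 2.
Proof. by rewrite /jetN /jet !exprMn sqr_normcE -mulrDr. Qed.

Lemma jetN_le_jetQ a f h x : (0 < mdeg a <= d)%N -> jetN a f h x <= jetQ f h x.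
Proof.
move=> /andP[a0 ad]; rewrite /jetQ.
have s1 : 0 <= \sum_(k < n) jetN (mnm1 k) f h x.
  by apply: sumr_ge0 => k _; exact: jetN_ge0.
have s2 : 0 <= \sum_(a : bmultinom n d.+1 | (1 < mdeg a)%N) jetN a f h x.
  by apply: sumr_ge0 => k _; exact: jetN_ge0.
have [a1|a1] := ltnP 1 (mdeg a).
  rewrite ler_wpDl// (bigD1 (BMultinom (ad : (mdeg a < d.+1)%N)))//= ler_wpDr//.
  by apply: sumr_ge0 => k _; exact: jetN_ge0.
have /mdeg1P[k /eqP ->] : mdeg a == 1%N by rewrite eqn_leq a1.
rewrite ler_wpDr// (bigD1 k)//= ler_wpDr//.
by apply: sumr_ge0 => l _; exact: jetN_ge0.
Qed.

Lemma jetQ_gt0 f h x : admissible f h -> 0 < jetQ f h x.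
Proof.
move=> [d0 h0 fd]; have [a ad [c c0 ac]] := mderivm_top fd.
apply: lt_le_trans (@jetN_le_jetQ a f h x _); last by rewrite ad d0 leqnn.
rewrite jetNE ac evalCC exprn_gt0// mulr_gt0 ?exprn_gt0 ?invr_gt0//.
rewrite lt_neqAle; apply/andP; split; last exact: normc_nneg.
by rewrite eq_sym; apply: contra_neq c0; exact: eq0_normc.
Qed.

Lemma mderivm_add1 a k f : mderivm (mnm_add a (mnm1 k)) f = mderiv k (mderivm a f).
Proof. by rewrite mderivmDm mderivmU1m. Qed.

Lemma der_jet u b a f h x : h != 0 ->
  is_derive x (delta_mx 0 u) (jet b a f h) (h * djet u b a f h x).
Proof.
move=> h0; have [dr di] := is_derive_evalC (mderivm a f) u x.
have E (b' : bool) : h * jet b' (mnm_add a (mnm1 (cvar u))) f h x =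
   h^-1 ^+ mdeg a * (if b' then imC (mderiv (cvar u) (mderivm a f)) x
     else reC (mderiv (cvar u) (mderivm a f)) x).
  by rewrite /jet mdegD mdeg1 addn1 exprS -!mulrA mulVKf// mderivm_add1.
rewrite /djet; move: dr di; rewrite /cdir.
have mulc F l : is_derive x (delta_mx 0 u) F l ->
    is_derive x (delta_mx 0 u) (fun y => h^-1 ^+ mdeg a * F y) (h^-1 ^+ mdeg a * l).
  by move=> dF; apply: is_derive_eq (der_mul (der_cst _ _ _) dF) _; rewrite mulr0 addr0.
case: (fintype.split u) => _ dr di.
  rewrite E; rewrite !mul1r in dr di.
  by case: b; [exact: mulc di|exact: mulc dr].
rewrite cReM cImM /= !mul0r !mul1r ?sub0r ?add0r in dr di.
case: b; rewrite ?mulrN E; first exact: mulc di.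
by rewrite -mulrN; exact: mulc dr.
Qed.

(** The derivative of [jetQ] along [u] divided by [2 * h]; the 2 cancels against the square root in
    [der_jetq]. *)
Definition djetQ u : family := fun f h x =>
  \sum_(k < n) (jet false (mnm1 k) f h x * djet u false (mnm1 k) f h x +
    jet true (mnm1 k) f h x * djet u true (mnm1 k) f h x) +
  \sum_(a : bmultinom n d.+1 | (1 < mdeg a)%N)
    (jet false a f h x * djet u false a f h x + jet true a f h x * djet u true a f h x).

Lemma der_jetQ u f h x : h != 0 ->
  is_derive x (delta_mx 0 u) (jetQ f h) (h * (2 * djetQ u f h x)).
Proof.
move=> h0; have dN a : is_derive x (delta_mx 0 u) (jetN a f h)
    (h * 2 * (jet false a f h x * djet u false a f h x +
       jet true a f h x * djet u true a f h x)).
  have := der_add (der_mul (der_jet u false a f x h0) (der_jet u false a f x h0))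
    (der_mul (der_jet u true a f x h0) (der_jet u true a f x h0)).
  by move=> D; apply: is_derive_eq D _; ring.
rewrite mulrA /djetQ mulrDr !mulr_sumr.
by apply: der_add; apply: der_sum.
Qed.

Lemma der_jetq u f h x : admissible f h ->
  is_derive x (delta_mx 0 u) (jetq f h)
    (h * (- (jetq f h x * (jetq f h x * jetq f h x * djetQ u f h x)))).
Proof.
move=> adm; have Q0 := jetQ_gt0 x adm; have [_ h0 _] := adm.
have dQ := der_jetQ u f x (lt0r_neq0 h0).
have s0 : Num.sqrt (jetQ f h x) != 0 by rewrite gt_eqF// sqrtr_gt0.
have D := der_comp dQ (is_derive1_sqrt Q0).
have V : is_derive (Num.sqrt (jetQ f h x)) 1 (fun y : R => y^-1)
    (- (Num.sqrt (jetQ f h x)) ^- 2 *: 1) by exact: is_deriveV.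
apply: is_derive_eq (der_comp D V) _; rewrite /jetq /GRing.scale/= mulr1.
by field.
Qed.

(** Symbols depend on [f], [h] and the point together, so that constants obtained by induction on
    them are uniform in [f] and [h]. A weight is only a lower bound: it may be decreased, and 0 has
    every weight. *)
Inductive symbol : family -> nat -> Prop :=
| symbol_cst c : symbol (fun _ _ _ => c) 0
| symbol_zero w : symbol (fun _ _ _ => 0) w
| symbol_q : symbol jetq 0
| symbol_jet b a : (0 < mdeg a)%N ->
    symbol (fun f h x => jet b a f h x * jetq f h x) (mdeg a).-1
| symbol_add s t w : symbol s w -> symbol t w ->
    symbol (fun f h x => s f h x + t f h x) w
| symbol_mul s t w v : symbol s w -> symbol t v ->
    symbol (fun f h x => s f h x * t f h x) (w + v)
| symbol_weak s w v : symbol s w -> (v <= w)%N -> symbol s v.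

Lemma symbol_ext s t w : symbol s w -> (forall f h x, s f h x = t f h x) -> symbol t w.
Proof. by move=> ss st; rewrite (_ : t = s)//; do 3 apply/funext => ?. Qed.

Lemma symbol_opp s w : symbol s w -> symbol (fun f h x => - s f h x) w.
Proof.
move=> ss; apply: symbol_ext (symbol_mul (symbol_cst (-1)) ss) _ => f h x.
by rewrite mulN1r.
Qed.

Lemma symbol_sum I (r : seq I) (P : pred I) (s : I -> family) w :
  (forall i, P i -> symbol (s i) w) ->
  symbol (fun f h x => \sum_(i <- r | P i) s i f h x) w.
Proof.
move=> ss; elim: r => [|i r IH].
  by apply: symbol_ext (symbol_zero w) _ => f h x; rewrite big_nil.
have [Pi|Pi] := boolP (P i); last first.
  by apply: symbol_ext IH _ => f h x; rewrite big_cons (negbTE Pi).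
by apply: symbol_ext (symbol_add (ss i Pi) IH) _ => f h x; rewrite big_cons Pi.
Qed.

Lemma symbol_djet u b a : symbol (fun f h x => djet u b a f h x * jetq f h x) (mdeg a).
Proof.
rewrite /djet; set a' := mnm_add a _.
have a'E : (mdeg a').-1 = mdeg a by rewrite mdegD mdeg1 addn1.
have a'0 : (0 < mdeg a')%N by rewrite mdegD mdeg1 addn1.
rewrite -a'E; case: (fintype.split u) => _; first exact: symbol_jet.
case: b; first exact: symbol_jet.
by apply: symbol_ext (symbol_opp (symbol_jet true a'0)) _ => f h x; rewrite mulNr.
Qed.

(** Each summand pairs a normalized jet of order [|a|] with one of order [|a| + 1], of total weight
    [2|a| - 1], which is at least 1. *)
Lemma symbol_djetQ u : symbol (fun f h x => jetq f h x * jetq f h x * djetQ u f h x) 1.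
Proof.
have sN a : (0 < mdeg a)%N -> symbol (fun f h x => jetq f h x * jetq f h x *
   (jet false a f h x * djet u false a f h x + jet true a f h x * djet u true a f h x)) 1.
  move=> a0; apply: symbol_ext (symbol_weak (symbol_add
     (symbol_mul (symbol_jet false a0) (symbol_djet u false a))
     (symbol_mul (symbol_jet true a0) (symbol_djet u true a))) _) _.
    by rewrite (leq_trans a0)// leq_addl.
  by move=> f h x; ring.
pose T a : family := fun f h x => jetq f h x * jetq f h x *
   (jet false a f h x * djet u false a f h x + jet true a f h x * djet u true a f h x).
have s1 : symbol (fun f h x => \sum_(k < n) T (mnm1 k) f h x) 1.
  by apply: (@symbol_sum _ _ _ (fun k => T (mnm1 k))) => k _; apply: sN; rewrite mdeg1.
have s2 : symbol (fun f h x => \sum_(a : bmultinom n d.+1 | (1 < mdeg a)%N) T a f h x) 1.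
  by apply: (@symbol_sum _ _ _ (fun a : bmultinom n d.+1 => T a)) => a /ltnW; exact: sN.
apply: symbol_ext (symbol_add s1 s2) _ => f h x.
by rewrite /djetQ mulrDr !mulr_sumr.
Qed.

(** Differentiating a jet raises its order by 1, and differentiating [jetq] multiplies it by the
    symbol of [symbol_djetQ], of weight 1; the Leibniz rule does the rest. *)
Lemma symbol_der s w u : symbol s w -> exists2 s', symbol s' w.+1 &
  forall f h, admissible f h -> forall x,
    is_derive x (delta_mx 0 u) (s f h) (h * s' f h x).
Proof.
elim=> {s w}.
- move=> c; exists (fun _ _ _ => 0); first exact: symbol_zero.
  by move=> f h _ x; rewrite mulr0; exact: der_cst.
- move=> w; exists (fun _ _ _ => 0); first exact: symbol_zero.
  by move=> f h _ x; rewrite mulr0; exact: der_cst.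
- exists (fun f h x => - (jetq f h x * (jetq f h x * jetq f h x * djetQ u f h x))).
    by apply: symbol_opp; exact: symbol_mul symbol_q (symbol_djetQ u).
  by move=> f h adm x; exact: der_jetq.
- move=> b a a0; exists (fun f h x => djet u b a f h x * jetq f h x -
     jet b a f h x * jetq f h x * (jetq f h x * jetq f h x * djetQ u f h x)).
    rewrite prednK//; apply: symbol_add; first exact: symbol_djet.
    apply: symbol_opp; apply: symbol_weak (symbol_mul (symbol_jet b a0) (symbol_djetQ u)) _.
    by rewrite addn1 prednK.
  move=> f h adm x; have [_ h0 _] := adm.
  apply: is_derive_eq (der_mul (der_jet u b a f x (lt0r_neq0 h0)) (der_jetq u x adm)) _.
  by ring.
- move=> s t w _ [s' ss' ds] _ [t' st' dt].
  exists (fun f h x => s' f h x + t' f h x); first exact: symbol_add.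
  by move=> f h adm x; rewrite mulrDr; apply: der_add; [exact: ds|exact: dt].
- move=> s t w v ss [s' ss' ds] st [t' st' dt].
  exists (fun f h x => s f h x * t' f h x + s' f h x * t f h x).
    by apply: symbol_add; [rewrite -addnS|rewrite -addSn]; exact: symbol_mul.
  move=> f h adm x; apply: is_derive_eq (der_mul (ds f h adm x) (dt f h adm x)) _.
  by ring.
- move=> s w v _ [s' ss' ds] vw; exists s' => //; exact: symbol_weak ss' _.
Qed.

Lemma continuous_jet b a f h : continuous (jet b a f h).
Proof.
have [cr ci] := continuous_evalC (mderivm a f).
have cc : continuous (cst (h^-1 ^+ mdeg a) : pt -> R) by exact: cst_continuous.
by case: b; [exact: (continuous_mulr cc ci)|exact: (continuous_mulr cc cr)].
Qed.

Lemma continuous_jetQ f h : continuous (jetQ f h).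
Proof.
have cN a : continuous (jetN a f h).
  have c b := continuous_mulr (@continuous_jet b a f h) (@continuous_jet b a f h).
  by move=> x; exact: cvgD (c false x) (c true x).
have c1 := @continuous_sumr _ _ _ (index_enum 'I_n) xpredT _ (fun k => cN (mnm1 k)).
have c2 := @continuous_sumr _ _ _ (index_enum (bmultinom n d.+1))
  (fun a : bmultinom n d.+1 => (1 < mdeg a)%N) _ (fun a : bmultinom n d.+1 => cN a).
by move=> x; exact: cvgD (c1 x) (c2 x).
Qed.

Lemma continuous_symbol s w f h : admissible f h -> symbol s w -> continuous (s f h).
Proof.
move=> adm; have cq : continuous (jetq f h).
  have sQ : continuous (fun x => Num.sqrt (jetQ f h x)).
    move=> x; apply: (@continuous_comp _ _ _ (jetQ f h) Num.sqrt).
      exact: continuous_jetQ.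
    exact: sqrt_continuous.
  move=> x; have s0 : Num.sqrt (jetQ f h x) != 0.
    by rewrite gt_eqF// sqrtr_gt0 jetQ_gt0.
  exact: cvgV s0 (sQ x).
elim=> {s w}.
- by move=> c; exact: cst_continuous.
- by move=> _; exact: cst_continuous.
- exact: cq.
- by move=> b a _; exact: continuous_mulr (@continuous_jet b a f h) cq.
- by move=> s t w _ cs _ ct x; exact: cvgD (cs x) (ct x).
- by move=> s t w v _ cs _ ct; exact: continuous_mulr cs ct.
- by [].
Qed.

End symbols.

(** * Bounds on symbols *)

Section symbol_bounds.
Context {R : realType}.
Variables n d : nat.
Local Notation pt := ('rV[R]_(n + n)).
Implicit Types (f : mpoly n R[i]) (h : R) (x : pt) (a : multinom n).

Definition spread1 a (k : 'I_n) f h x : R :=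
  ratio (normc (evalC (mderiv k (mderivm a f)) (toC x)))
    (h * normc (evalC (mderivm a f) (toC x))).

Definition spread f h x : R :=
  \sum_(a : bmultinom n d.+1 | (0 < mdeg a)%N) \sum_(k < n) spread1 a k f h x.

(** The cap at 1 makes higher powers smaller; the factor 2 is the loss in [ratio_small]. *)
Definition rate f h x : R := Num.min 1 (2 * spread f h x).

Lemma spread_ge0 f h x : 0 <= spread f h x.
Proof. by apply: sumr_ge0 => a _; apply: sumr_ge0 => k _; exact: ratio_ge0. Qed.

Lemma rate_ge0 f h x : 0 <= rate f h x.
Proof. by rewrite /rate le_min ler01 mulr_ge0// spread_ge0. Qed.

Lemma rate_le1 f h x : rate f h x <= 1.
Proof. by rewrite /rate ge_min lexx. Qed.

Lemma spread1_le a k f h x : (0 < mdeg a <= d)%N -> spread1 a k f h x <= spread f h x.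
Proof.
move=> /andP[a0 ad]; rewrite /spread.
rewrite (bigD1 (BMultinom (ad : (mdeg a < d.+1)%N)))//= ler_wpDr//.
  by apply: sumr_ge0 => b _; apply: sumr_ge0 => l _; exact: ratio_ge0.
rewrite (bigD1 k)//= ler_wpDr//.
by apply: sumr_ge0 => l _; exact: ratio_ge0.
Qed.

(** The bound on the ratio reads [(1 - v) X^2 <= v Y^2], and [1 - v] is at least 1/2. *)
Lemma ratio_small (X Y v : R) : 0 <= v -> 2 * v <= 1 -> ratio X Y <= v ->
  X ^+ 2 <= 2 * v * Y ^+ 2.
Proof.
move=> v0 v1; have X2 := sqr_ge0 X; have Y2 := sqr_ge0 Y.
have [X0|Xn0] := eqVneq X 0.
  by move=> _; rewrite X0 expr0n /=; do 2 apply: mulr_ge0 => //.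
have Xp : 0 < X ^+ 2 by rewrite lt_neqAle eq_sym sqrf_eq0 Xn0.
rewrite /ratio ler_pdivrMr; last by rewrite ltr_pwDl.
move: (X ^+ 2) (Y ^+ 2) X2 Y2 Xp => P Q *; nra.
Qed.

(** Jets of order above [d] vanish. If the rate is 1, the jet is a term of [jetQ]. Otherwise one
    index is removed from [a], and [ratio_small] bounds the jet by [rate] times the one of lower
    order; this is repeated down to order 1. *)
Lemma jetN_le_rate f h x m a : 0 < h -> has_degree d f -> mdeg a = m.+1 ->
  jetN a f h x <= rate f h x ^+ m * jetQ d f h x.
Proof.
move=> h0 fd; elim: m a => [|m IH] a am.
  have [ad|ad] := leqP (mdeg a) d.
    by rewrite expr0 mul1r jetN_le_jetQ// ad am.
  rewrite jetNE mderivm_eq0 ?fd// /evalC meval0 normc0 mulr0 expr0n/=.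
  rewrite mulr_ge0 ?exprn_ge0 ?rate_ge0//.
  by rewrite addr_ge0// sumr_ge0// => *; exact: jetN_ge0.
have [ad|ad] := leqP (mdeg a) d; last first.
  rewrite jetNE mderivm_eq0 ?fd// /evalC meval0 normc0 mulr0 expr0n/=.
  rewrite mulr_ge0 ?exprn_ge0 ?rate_ge0//.
  by rewrite addr_ge0// sumr_ge0// => *; exact: jetN_ge0.
have [s1|s1] := leP 1 (2 * spread f h x).
  by rewrite /rate min_l// expr1n mul1r jetN_le_jetQ// ad am.
have [k ak] : exists k, a k != 0%N.
  apply: contrapT => na; have : a = mnm0.
    apply/mnmP => k; rewrite mnm0E; apply/eqP; apply: contrapT => ak.
    by apply: na; exists k; apply/negP.
  by move=> a0; rewrite a0 mdeg0 in am.
pose b := mnm_sub a (mnm1 k).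
have aE : a = mnm_add b (mnm1 k) by rewrite /b submK// lep1mP.
have bm : mdeg b = m.+1.
  by apply/eqP; rewrite -eqSS -am aE mdegD mdeg1 addn1.
suff ab : jetN a f h x <= rate f h x * jetN b f h x.
  by rewrite (le_trans ab)// exprS -mulrA ler_wpM2l ?rate_ge0// IH.
rewrite {1}aE !jetNE mderivm_add1 mdegD mdeg1 addn1 /rate min_r ?(ltW s1)//.
have b1 : (0 < mdeg b <= d)%N by rewrite bm /= (leq_trans _ ad)// am.
have := ratio_small (spread_ge0 f h x) (ltW s1) (spread1_le k f h x b1).
set X := normc _; set Y := normc _ => XY.
rewrite [h^-1 ^+ _.+1]exprS; move: (h^-1 ^+ mdeg b) => p.
rewrite [leLHS](_ : _ = p ^+ 2 * (h^-1 ^+ 2 * X ^+ 2)); last by ring.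
rewrite [leRHS](_ : _ = p ^+ 2 * (2 * spread f h x * Y ^+ 2)); last by ring.
rewrite ler_wpM2l ?sqr_ge0// exprVn mulrC ler_pdivrMr ?exprn_gt0//.
by move: XY; rewrite exprMn mulrA mulrAC.
Qed.

(** A normalized jet of weight [w] has square at most [rate ^+ w] by [jetN_le_rate]; squares are
    used throughout to avoid half-integral powers. *)
Lemma symbol_bound s w : symbol d s w -> exists2 C : R, 0 <= C &
  forall f h, admissible d f h -> forall x, 1 <= jetQ d f h x ->
    s f h x ^+ 2 <= C * rate f h x ^+ w.
Proof.
elim=> {s w}.
- by move=> c; exists (c ^+ 2); rewrite ?sqr_ge0// => f h _ x _; rewrite expr0 mulr1.
- by move=> w; exists 0 => // f h _ x _; rewrite mul0r expr0n.
- exists 1 => // f h _ x Q1; rewrite expr0 mulr1 /jetq exprVn sqr_sqrtr ?invf_le1//.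
    exact: lt_le_trans Q1.
  exact: le_trans Q1.
- move=> b a a0; exists 1 => // f h [_ h0 fd] x Q1.
  have Q0 : 0 < jetQ d f h x by exact: lt_le_trans Q1.
  rewrite mul1r /jetq exprMn exprVn sqr_sqrtr ?(ltW Q0)// ler_pdivrMr//.
  apply: le_trans (@jetN_le_rate f h x (mdeg a).-1 a h0 fd _); last by rewrite prednK.
  by case: b; rewrite /jetN ?lerDl ?lerDr sqr_ge0.
- move=> s t w _ [C C0 sC] _ [D D0 tD]; exists (2 * (C + D)).
    by rewrite mulr_ge0// addr_ge0.
  move=> f h adm x Q1; have := sC f h adm x Q1; have := tD f h adm x Q1.
  move: (rate _ _ _ ^+ w) (s f h x) (t f h x) => r S T TD SC.
  have -> : 2 * (C + D) * r = 2 * (C * r) + 2 * (D * r) by ring.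
  by have := sqr_ge0 (S - T); rewrite !sqrrD sqrrN mulrN; lra.
- move=> s t w v _ [C C0 sC] _ [D D0 tD]; exists (C * D); first exact: mulr_ge0.
  move=> f h adm x Q1; rewrite exprMn exprD [leRHS]mulrACA.
  by apply: ler_pM; rewrite ?sqr_ge0//; [exact: sC|exact: tD].
- move=> s w v _ [C C0 sC] vw; exists C => // f h adm x Q1.
  apply: le_trans (sC f h adm x Q1) _; apply: ler_wpM2l => //.
  by apply: ler_wiXn2l; rewrite ?rate_ge0 ?rate_le1.
Qed.

End symbol_bounds.

(** * Integration by parts *)

Section oscillatory_estimate.
Context {R : realType}.
Variables n d : nat.
Local Notation m := (n + n)%N.
Local Notation pt := ('rV[R]_m).
Local Notation family := (mpoly n R[i] -> R -> pt -> R).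
(** [chi] stands for the real or imaginary part of the test function, [S] for the support of the
    latter, and [B] for the half-side of a box containing it. *)
Variables (chi : pt -> R) (S : set pt) (B : R).
Hypotheses (chi_smooth : smooth chi) (cS : compact S) (clS : closed S)
  (chi0 : forall x, ~ S x -> chi x = 0) (B1 : 1 <= B)
  (SB : forall x, S x -> forall j, `|x ord0 j| <= B).

Definition dchi (s : seq 'I_m) : pt -> R := foldr (@pderiv R m) chi s.

Lemma continuous_dchi s : continuous (dchi s).
Proof. by have [] := chi_smooth s. Qed.

Lemma der_dchi s u x : is_derive x (delta_mx 0 u) (dchi s) (dchi (u :: s) x).
Proof. by apply: derivableP; have [_] := chi_smooth s; apply. Qed.

Lemma dchi_off s x : ~ S x -> dchi s x = 0.
Proof.
elim: s x => [|u s IH] x nSx; first exact: chi0.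
rewrite /dchi /= -/(dchi s) /pderiv.
rewrite (@near_eq_derive _ _ _ _ (cst 0)) ?derive_cst//.
have oS : open (~` S) by exact: closed_openC.
have := open_nbhs_nbhs (conj oS nSx : open_nbhs x (~` S)).
by apply: filterS => y; exact: IH.
Qed.

Lemma dchi_bounded s : exists2 M, 0 <= M & forall x, `|dchi s x| <= M.
Proof.
have [M [_ /(_ (`|M| + 1))]] : bounded_set (dchi s @` S).
  apply: (@compact_bounded R R^o).
  apply: continuous_compact; last exact: cS.
  by apply: continuous_subspaceT => x; exact: continuous_dchi.
rewrite (le_lt_trans (ler_norm _)) ?ltrDl// => /(_ isT) HM.
exists (`|M| + 1); first by rewrite addr_ge0.
move=> x; have [Sx|nSx] := pselect (S x); first by apply: HM; exists x.
by rewrite dchi_off// normr0 addr_ge0.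
Qed.

(** The number [h] will be the infimum of the height over the support. The last condition gives
    [jetq <= 1] on [S], and [1 <= h] allows surplus factors [h^-1] to be dropped. *)
Definition normalized (f : mpoly n R[i]) (h : R) :=
  [/\ admissible d f h, 1 <= h & forall x : pt, S x -> 1 <= jetQ d f h x].

Definition box_continuous (G : pt -> R) :=
  continuous G /\ forall x : pt, (exists j, B < `|x ord0 j|) -> G x = 0.

Definition integ (G : pt -> R) : R := \int[lebesgue_tuple m]_t G (rowt t).

Lemma off_box (x : pt) : (exists j, B < `|x ord0 j|) -> ~ S x.
Proof. by move=> [j Bj] Sx; have := SB Sx j; rewrite leNgt Bj. Qed.

Lemma box_continuous_integrable G : box_continuous G ->
  (lebesgue_tuple m).-integrable setT (EFin \o (fun t => G (rowt t))).
Proof. by move=> [cG G0]; exact: (box_integrable (le_trans ler01 B1) cG G0). Qed.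

Lemma box_continuousD F G : box_continuous F -> box_continuous G -> box_continuous (fun x => F x + G x).
Proof.
move=> [cF F0] [cG G0]; split; first by move=> x; exact: cvgD (cF x) (cG x).
by move=> x xj; rewrite F0// G0// addr0.
Qed.

Lemma box_continuousZ c F : box_continuous F -> box_continuous (fun x => c * F x).
Proof.
move=> [cF F0]; split; last by move=> x xj; rewrite F0// mulr0.
have cc : continuous (cst c : pt -> R) by exact: cst_continuous.
exact: (continuous_mulr cc cF).
Qed.

Lemma box_continuous_sum I (r : seq I) (F : I -> pt -> R) : (forall i, box_continuous (F i)) ->
  box_continuous (fun x => \sum_(i <- r) F i x).
Proof.
move=> cF; split; first by apply: continuous_sumr => i; case: (cF i).
by move=> x xj; rewrite big1// => i _; case: (cF i) => _; apply.
Qed.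

Lemma intD F G : box_continuous F -> box_continuous G -> integ (fun x => F x + G x) = integ F + integ G.
Proof. by move=> cF cG; apply: RintegralD => //; exact: box_continuous_integrable. Qed.

Lemma intZ c F : box_continuous F -> integ (fun x => c * F x) = c * integ F.
Proof. by move=> cF; apply: RintegralZl => //; exact: box_continuous_integrable. Qed.

Lemma int_sum I (r : seq I) (F : I -> pt -> R) : (forall i, box_continuous (F i)) ->
  integ (fun x => \sum_(i <- r) F i x) = \sum_(i <- r) integ (F i).
Proof.
move=> cF; elim: r => [|i r IH].
  rewrite big_nil; have -> : (fun x => \sum_(i <- [::]) F i x) = (fun x => 0 * 0).
    by apply/funext => x; rewrite big_nil mul0r.
  rewrite (@intZ 0 (fun=> 0)) ?mul0r//.
  by split => //; exact: cst_continuous.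
rewrite big_cons -IH -intD//; last exact: box_continuous_sum.
by congr integ; apply/funext => x; rewrite big_cons.
Qed.

Lemma normr_int_le G (w : m.-tuple (measurableTypeR R) -> R) c :
  box_continuous G -> (forall t, 0 <= w t) ->
  (forall t, box B t -> `|G (rowt t)| <= w t) ->
  (\int[lebesgue_tuple m]_(t in box B) (w t)%:E <= c%:E)%E -> `|integ G| <= c.
Proof.
move=> ccG w0 Gw wc; have iG := box_continuous_integrable ccG.
have [_ G0] := ccG.
rewrite -lee_fin; apply: le_trans wc.
have fG : (\int[lebesgue_tuple m]_t (G (rowt t))%:E)%E \is a fin_num.
  exact: integrable_fin_num iG.
have mG : measurable_fun setT (fun t : m.-tuple (measurableTypeR R) => (G (rowt t))%:E).
  by apply/measurable_EFinP; apply: continuous_rowt_measurable; case: ccG.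
have H := @le_abse_integral _ _ _ (lebesgue_tuple m) _ _ measurableT mG.
rewrite -(fineK fG) in H; apply: (le_trans H).
rewrite [leRHS]integral_mkcond; apply: ge0_le_integral_nomeas => t //.
rewrite patchE; case: ifPn => [/set_mem bt|/negP bt]; first by rewrite lee_fin Gw.
rewrite G0; first by rewrite abse0.
apply: contra_notP bt => nj; apply/mem_set => k.
rewrite /= in_itv/= -ler_norml leNgt; apply/negP => Bk; apply: nj.
by exists k; rewrite mxE.
Qed.

(** The shift [c] turns sines into cosines, so that [osc] covers the real and imaginary parts of the
    exponential and is stable under integration by parts. *)
Definition phase (f : mpoly n R[i]) (c : R) (x : pt) : R := 2 * pi * (reC f x + imC f x) + c.

Lemma cos_phase_shift f c x : cos (phase f (c - pi / 2) x) = sin (phase f c x).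
Proof. by rewrite /phase addrA cosBpihalf. Qed.

Definition osc f h c s (sy : family) (x : pt) : R := cos (phase f c x) * (sy f h x * dchi s x).

Lemma box_continuous_cos f c F : box_continuous F -> box_continuous (fun x => cos (phase f c x) * F x).
Proof.
move=> [cF F0]; split; last by move=> x /F0 ->; rewrite mulr0.
have [cr ci] := continuous_evalC f.
have cph : continuous (phase f c).
  have cri : continuous (reC f + imC f) by move=> x; exact: cvgD (cr x) (ci x).
  have c1 : continuous (cst (2 * pi) : pt -> R) by exact: cst_continuous.
  have c2 : continuous (cst c : pt -> R) by exact: cst_continuous.
  have c3 := continuous_mulr c1 cri.
  by move=> x; exact: cvgD (c3 x) (c2 x).
have ccos : continuous (fun x => cos (phase f c x)).
  move=> x; apply: (@continuous_comp _ _ _ (phase f c) cos); first exact: cph.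
  exact: continuous_cos.
exact: continuous_mulr ccos cF.
Qed.

Lemma box_continuous_osc f h c s sy w : normalized f h -> symbol d sy w -> box_continuous (osc f h c s sy).
Proof.
move=> [adm _ _] ssy; apply: box_continuous_cos; split; last first.
  by move=> x /off_box nS; rewrite dchi_off// mulr0.
exact: continuous_mulr (continuous_symbol adm ssy) (@continuous_dchi s).
Qed.

Lemma mmeasure_mderivm a (f : mpoly n R[i]) :
  (mmeasure mdeg (mderivm a f) <= mmeasure mdeg f)%N.
Proof.
rewrite [X in (X <= _)%N]mmeasureE; apply/bigmax_leqP_seq => b bf _.
move: bf; rewrite mcoeff_msupp mcoeff_mderivm => bf.
apply: leq_trans (msize_mdeg_lt (_ : mnm_add a b \in msupp f)).
  by rewrite ltnS mdegD leq_addl.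
by rewrite mcoeff_msupp; apply: contra_neq bf => ->; rewrite mul0rn.
Qed.

(** Repeated use of [(a + b)^2 <= 2 (a^2 + b^2)]; the constant depends only on the number of
    terms. *)
Lemma sqr_sum_le I (r : seq I) (P : pred I) (F : I -> R) :
  (\sum_(i <- r | P i) F i) ^+ 2 <= 2 ^+ size r * \sum_(i <- r | P i) F i ^+ 2.
Proof.
elim: r => [|i r IH]; first by rewrite !big_nil expr0n mulr0.
rewrite !big_cons /= [2 ^+ _.+1]exprS.
have s0 : 0 <= \sum_(j <- r | P j) F j ^+ 2 by apply: sumr_ge0 => j _; exact: sqr_ge0.
have p1 : 1 <= 2 ^+ size r :> R by rewrite exprn_ege1// ler1n.
case: ifP => _; last first.
  apply: le_trans IH _; rewrite -mulrA ler_peMl ?ler1n//.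
  by apply: mulr_ge0 => //; exact: le_trans p1.
move: IH p1 s0; set X := \sum_(j <- r | _) _; set Y := \sum_(j <- r | _) _.
move: (2 ^+ _) => p IH p1 s0.
have h1 := sqr_ge0 (F i - X); have h2 := sqr_ge0 (F i).
have h3 : F i ^+ 2 <= p * F i ^+ 2 by rewrite ler_peMl.
have -> : 2 * p * (F i ^+ 2 + Y) = 2 * (p * F i ^+ 2) + 2 * (p * Y) by ring.
by move: h1; rewrite !sqrrD sqrrN mulrN; lra.
Qed.

Lemma osc_le_rate s sy v : symbol d sy (v + v) -> exists2 C : R, 0 <= C &
  forall f h, normalized f h -> forall c x, `|osc f h c s sy x| <= C * rate d f h x ^+ v.
Proof.
move=> ssy; have [C C0 sC] := symbol_bound ssy.
have [M M0 sM] := dchi_bounded s.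
(* [C <= (C + 1)^2] replaces a square root of [C]. *)
exists ((C + 1) * M); first by rewrite mulr_ge0// addr_ge0.
move=> f h [adm h1 Q1] c x; have r0 := exprn_ge0 v (rate_ge0 d f h x).
have [Sx|nSx] := pselect (S x); last first.
  by rewrite /osc dchi_off// !mulr0 normr0 !mulr_ge0// addr_ge0.
have c1 : `|cos (phase f c x)| <= 1 by rewrite ler_norml cos_geN1 cos_le1.
have sle : `|sy f h x| <= (C + 1) * rate d f h x ^+ v.
  rewrite -ler_sqr ?nnegrE// ?mulr_ge0 ?addr_ge0// real_normK ?num_real//.
  apply: le_trans (sC f h adm x (Q1 x Sx)) _; rewrite exprD exprMn -expr2.
  by rewrite ler_wpM2r ?sqr_ge0// sqrrD expr1n mulr1; have := sqr_ge0 C; lra.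
rewrite /osc !normrM mulrAC -[leRHS]mul1r.
by apply: ler_pM => //; apply: ler_pM.
Qed.

Lemma integral_box_cst (c : R) : 0 <= c ->
  (\int[lebesgue_tuple m]_(t in box B) c%:E)%E = (c * (2 * B) ^+ m)%:E.
Proof.
move=> c0; rewrite integral_cst; last exact: measurable_box.
by have /= -> := @lebesgue_box R m B (le_trans ler01 B1).
Qed.

Lemma osc_bounded s sy w : symbol d sy w -> exists2 C : R, 0 <= C &
  forall f h, normalized f h -> forall c, `|integ (osc f h c s sy)| <= C.
Proof.
move=> ssy; have [C C0 HC] := osc_le_rate s (symbol_weak ssy (leq0n w) : symbol d sy (0 + 0)).
exists (C * (2 * B) ^+ m).
  by rewrite mulr_ge0// exprn_ge0// mulr_ge0// (le_trans ler01 B1).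
move=> f h gfh c; apply: (@normr_int_le _ (fun=> C)) => //.
- exact: box_continuous_osc ssy.
- by move=> t _; have := HC f h gfh c (rowt t); rewrite expr0 mulr1.
- by rewrite integral_box_cst.
Qed.

Lemma spread_integral f h : 0 < h -> has_degree d f ->
  (\int[lebesgue_tuple m]_(t in box B)
    (\sum_(a : bmultinom n d.+1) \sum_(k < n) spread1 a k f h (rowt t) ^+ 2)%R%:E
  <= ((\sum_(a : bmultinom n d.+1) \sum_(k < n)
        (d%:R ^+ 5 * (pi / h) ^+ 2 * (2 * B) ^+ m))%R%:E : \bar R))%E.
Proof.
move=> h0 fd.
have mF (a : bmultinom n d.+1) (k : 'I_n) : measurable_fun (box B)
    (fun t : m.-tuple (measurableTypeR R) => (spread1 a k f h (rowt t) ^+ 2)%:E).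
  apply/measurable_EFinP; apply: (@measurable_funS _ _ _ _ setT) => //.
  by apply: measurable_funX; exact: measurable_ratio.
have mbox := @measurable_box R m B.
under eq_integral do rewrite -sumEFin.
under eq_integral do under eq_bigr do rewrite -sumEFin.
rewrite ge0_integral_sum//; last 2 first.
- by move=> a; apply: emeasurable_sum => k; exact: mF.
- by move=> a t _; apply: sume_ge0 => k _; rewrite lee_fin sqr_ge0.
rewrite -sumEFin; apply: lee_sum => a _.
rewrite ge0_integral_sum//; last by move=> k t _; rewrite lee_fin sqr_ge0.
rewrite -sumEFin; apply: lee_sum => k _.
rewrite EFinM; apply: ratio_box_integral => //.
by apply: leq_trans (mmeasure_mderivm a f) _; rewrite fd.
Qed.

(** Weight 4 bounds the integrand by the square of the rate, hence by squares of the ratios, whose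
    integrals over the box are of order [h^-2]. *)
Lemma osc_weight4 s sy w : symbol d sy w -> (4 <= w)%N -> exists2 C : R, 0 <= C &
  forall f h, normalized f h -> forall c, `|integ (osc f h c s sy)| <= C * h^-1 ^+ 2.
Proof.
move=> ssy w4; have [C C0 HC] := osc_le_rate s (symbol_weak ssy w4 : symbol d sy (2 + 2)).
pose N := size (index_enum (bmultinom n d.+1)); pose N' := size (index_enum 'I_n).
(* The 4 comes from the square of [2 * spread], the two powers of 2 from [sqr_sum_le] over the
   multi-indices and over the variables. *)
pose K := C * 4 * 2 ^+ N * 2 ^+ N'.
have K0 : 0 <= K by rewrite !mulr_ge0// exprn_ge0.
pose T := \sum_(a : bmultinom n d.+1) \sum_(k < n) (d%:R ^+ 5 * pi ^+ 2 * (2 * B) ^+ m) : R.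
exists (K * T).
  apply: mulr_ge0 => //; apply: sumr_ge0 => a _; apply: sumr_ge0 => k _.
  have B0 := le_trans ler01 B1.
  by rewrite !mulr_ge0 ?exprn_ge0 ?mulr_ge0 ?pi_ge0.
move=> f h gfh c; have [[_ h0 fd] _ _] := gfh.
have s20 (a : bmultinom n d.+1) x : 0 <= \sum_(k < n) spread1 a k f h x ^+ 2.
  by apply: sumr_ge0 => k _; exact: sqr_ge0.
apply: (@normr_int_le _ (fun t => K * \sum_(a : bmultinom n d.+1) \sum_(k < n)
    spread1 a k f h (rowt t) ^+ 2)).
- exact: box_continuous_osc ssy.
- by move=> t; apply: mulr_ge0 => //; apply: sumr_ge0.
- move=> t _; apply: le_trans (HC f h gfh c (rowt t)) _.
  set x := rowt t; rewrite /K -!mulrA ler_wpM2l//.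
  apply: (@le_trans _ _ (4 * spread d f h x ^+ 2)).
    have -> : 4 * spread d f h x ^+ 2 = (2 * spread d f h x) ^+ 2 by ring.
    by rewrite ler_sqr ?nnegrE ?rate_ge0 ?mulr_ge0 ?spread_ge0// /rate ge_min lexx orbT.
  rewrite ler_wpM2l//; apply: le_trans (sqr_sum_le _ _ _) _.
  rewrite ler_wpM2l ?exprn_ge0// mulr_sumr big_mkcond; apply: ler_sum => a _.
  case: ifP => _; last by rewrite mulr_ge0// exprn_ge0.
  exact: sqr_sum_le.
have mF : measurable_fun (box B) (fun t : m.-tuple (measurableTypeR R) =>
    (\sum_(a : bmultinom n d.+1) \sum_(k < n) spread1 a k f h (rowt t) ^+ 2)%:E).
  apply/measurable_EFinP; apply: measurable_sum => a; apply: measurable_sum => k.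
  apply: (@measurable_funS _ _ _ _ setT) => //.
  by apply: measurable_funX; exact: measurable_ratio.
under eq_integral do rewrite EFinM.
rewrite ge0_integralZl_EFin//.
- have -> : (K * T * h^-1 ^+ 2)%:E = (K%:E * (T * h^-1 ^+ 2)%:E)%E by rewrite -mulrA.
  apply: lee_wpmul2l; first by rewrite lee_fin.
  apply: le_trans (spread_integral h0 fd) _; rewrite lee_fin /T !mulr_suml.
  apply: ler_sum => a _; apply: ler_sum => k _.
  by rewrite le_eqVlt; apply/orP; left; apply/eqP; rewrite exprMn; ring.
- exact: measurable_box.
- by move=> t _; rewrite lee_fin; apply: sumr_ge0.
Qed.

(** Normalized so that the derivative of the phase along [u] is
    [2 * pi * h * phase_der u / jetq]. *)
Definition phase_der u : family := fun f h x =>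
  (djet u false mnm0 f h x + djet u true mnm0 f h x) * jetq d f h x.

Lemma symbol_phase_der u : symbol d (phase_der u) 0.
Proof.
have := symbol_add (@symbol_djet R n d u false mnm0) (@symbol_djet R n d u true mnm0).
rewrite mdeg0 => ss; apply: symbol_ext ss _ => f h x.
by rewrite /phase_der mulrDl.
Qed.

Lemma der_phase u f h c x : h != 0 -> is_derive x (delta_mx 0 u) (phase f c)
  (2 * pi * (h * (djet u false mnm0 f h x + djet u true mnm0 f h x))).
Proof.
move=> h0.
have D := der_add (der_mul (der_cst (2 * pi) x (delta_mx 0 u))
  (der_add (der_jet u false mnm0 f x h0) (der_jet u true mnm0 f x h0)))
  (der_cst c x (delta_mx 0 u)).
have -> : phase f c = (fun y => 2 * pi * (jet false mnm0 f h y + jet true mnm0 f h y) + c).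
  by apply/funext => y; rewrite /phase /jet mdeg0 expr0 !mul1r mderivm0m.
by apply: is_derive_eq D _; ring.
Qed.

Definition jet2 : family := fun f h x =>
  \sum_(a : bmultinom n d.+1 | (1 < mdeg a)%N)
    ((jet false a f h x * jetq d f h x) * (jet false a f h x * jetq d f h x) +
     (jet true a f h x * jetq d f h x) * (jet true a f h x * jetq d f h x)).

Lemma symbol_jet2 : symbol d jet2 1.
Proof.
apply: (@symbol_sum _ _ _ _ _ _ (fun a : bmultinom n d.+1 => fun f h x =>
   (jet false a f h x * jetq d f h x) * (jet false a f h x * jetq d f h x) +
   (jet true a f h x * jetq d f h x) * (jet true a f h x * jetq d f h x))) => a a1.
have a0 : (0 < mdeg a)%N by exact: ltnW.
have sb b := symbol_mul (@symbol_jet R n d b a a0) (@symbol_jet R n d b a a0).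
apply: symbol_weak (symbol_add (sb false) (sb true)) _.
by rewrite (leq_trans _ (leq_addr _ _))// -ltnS prednK.
Qed.

(** This is [jetq^2 * jetQ = 1]. With [p] and [q] the real and imaginary jets of first order in the
    [k]-th variable, the phase has derivatives proportional to [p + q] and [p - q], whose squares
    add up to [2 (p^2 + q^2)]; hence the factor 1/2. *)
Lemma phase_der_split f h x : admissible d f h ->
  \sum_u 2^-1 * (phase_der u f h x * phase_der u f h x) + jet2 f h x = 1.
Proof.
move=> adm; have Q0 := jetQ_gt0 x adm.
have qQ : jetq d f h x ^+ 2 * jetQ d f h x = 1.
  by rewrite /jetq exprVn sqr_sqrtr ?(ltW Q0)// mulVf// gt_eqF.
rewrite -[RHS]qQ /jetQ mulrDr; congr (_ + _); last first.
  by rewrite /jet2 mulr_sumr; apply: eq_bigr => a _; rewrite /jetN; ring.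
rewrite big_split_ord/= -big_split/= mulr_sumr; apply: eq_bigr => k _.
rewrite /phase_der /djet /cvar.
have -> : fintype.split (lshift n k) = inl k by exact: (unsplitK (inl k)).
have -> : fintype.split (rshift n k) = inr k by exact: (unsplitK (inr k)).
have -> : mnm_add mnm0 (mnm1 k) = mnm1 k by apply/mnmP => j; rewrite mnmDE mnm0E.
by rewrite /jetN; field.
Qed.

(** The derivative along [u] of [sin (phase) * sy1 * dchi s] has integral 0. The sine yields the
    left-hand side times [h], [sy1] yields [h * sy'], and the cutoff yields a term without [h];
    dividing by [h] gives the claim. *)
Lemma osc_by_parts u s sy w : symbol d sy w -> exists2 sy', symbol d sy' w.+1 &
  exists2 sy1, symbol d sy1 w &
  forall f h, normalized f h -> forall c,
    2 * pi * integ (osc f h c s (fun f h x => phase_der u f h x * phase_der u f h x * sy f h x)) =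
    - integ (osc f h (c - pi / 2) s sy') - h^-1 * integ (osc f h (c - pi / 2) (u :: s) sy1).
Proof.
move=> ssy; pose sy1 : family := fun f h x => jetq d f h x * (phase_der u f h x * sy f h x).
have ssy1 : symbol d sy1 w.
  exact: symbol_mul (@symbol_q R n d) (symbol_mul (symbol_phase_der u) ssy).
have [sy' ssy' dsy'] := symbol_der u ssy1.
exists sy' => //; exists sy1 => // f h gfh c; have [adm h1 Q1] := gfh.
have h0 : h != 0 by rewrite gt_eqF//; lra.
pose sy2 : family := fun f h x => phase_der u f h x * phase_der u f h x * sy f h x.
have ssy2 : symbol d sy2 w.
  exact: symbol_mul (symbol_mul (symbol_phase_der u) (symbol_phase_der u)) ssy.
rewrite -/sy2.
pose dG x := 2 * pi * h * osc f h c s sy2 x + (h * osc f h (c - pi / 2) s sy' x +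
  osc f h (c - pi / 2) (u :: s) sy1 x).
have c2 := box_continuous_osc c s gfh ssy2.
have c' := box_continuous_osc (c - pi / 2) s gfh ssy'.
have c1 := box_continuous_osc (c - pi / 2) (u :: s) gfh ssy1.
have ccG : box_continuous (fun x => sin (phase f c x) * (sy1 f h x * dchi s x)).
  have := box_continuous_osc (c - pi / 2) s gfh ssy1.
  by congr box_continuous; apply/funext => x; rewrite /osc cos_phase_shift.
have dGE : integ dG = 0.
  apply: (@Rintegral_partial0 R m u (fun x => sin (phase f c x) * (sy1 f h x * dchi s x)) dG B).
  - exact: lt_le_trans ltr01 B1.
  - move=> x.
    have D := der_mul (der_comp (der_phase u f c x h0) (is_derive_sin _))
      (der_mul (dsy' f h adm x) (der_dchi s u x)).
    apply: is_derive_eq D _; rewrite /dG /osc !cos_phase_shift.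
    by rewrite /sy2 /sy1 /phase_der; ring.
  - have [cdG _] := box_continuousD (box_continuousZ (2 * pi * h) c2) (box_continuousD (box_continuousZ h c') c1).
    exact: cdG.
  - by case: ccG.
  - by case: (box_continuousD (box_continuousZ (2 * pi * h) c2) (box_continuousD (box_continuousZ h c') c1)).
move: dGE; rewrite /dG intD; [|exact: box_continuousZ|by apply: box_continuousD => //; exact: box_continuousZ].
rewrite intD//; last exact: box_continuousZ.
rewrite !intZ// => E; apply: (mulfI h0); move: E.
rewrite mulrBr mulrN mulVKf//; lra.
Qed.

(* Downward induction on [p + w]: integrating by parts either increases the
   weight or gains a factor [h^-1] by hitting [chi]. *)
Lemma osc_decay k p w s sy : (5 <= p + w + k)%N -> symbol d sy w -> exists2 C : R, 0 <= C &
  forall f h, normalized f h -> forall c,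
    `|integ (osc f h c s sy)| * h^-1 ^+ p <= C * h^-1 ^+ 2.
Proof.
have hp (h : R) q : 1 <= h -> 0 <= h^-1 ^+ q <= 1.
  by move=> h1; rewrite exprn_ge0 ?exprn_ile1 ?invr_ge0 ?invf_le1//; lra.
elim: k p w s sy => [|k IH] p w s sy pwk ssy.
  (* Here [p + w] is at least 5: either two factors [h^-1] are present and boundedness suffices, or
     [p <= 1] and the weight is at least 4. *)
  have [p2|p1] := leqP 2 p.
    have [C C0 HC] := osc_bounded s ssy; exists C => // f h gfh c; have [_ h1 _] := gfh.
    apply: ler_pM => //; [by case/andP: (hp h p h1)|exact: HC|].
    by apply: ler_wiXn2l => //; have := hp h 1%N h1; rewrite expr1 => /andP[].
  have w4 : (4 <= w)%N.
    by rewrite addn0 in pwk; case: p p1 pwk => [|[|p]] // _; rewrite ?add0n ?add1n// => /ltnW.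
  have [C C0 HC] := osc_weight4 s ssy w4; exists C => // f h gfh c; have [_ h1 _] := gfh.
  apply: le_trans (HC f h gfh c); rewrite ler_piMr//.
  by case/andP: (hp h p h1).
have ssyb := symbol_mul symbol_jet2 ssy.
have pw1 : (5 <= p + w.+1 + k)%N by rewrite addnS addSn -addnS.
have pw2 : (5 <= p.+1 + w + k)%N by rewrite addSn addSn -addnS.
have [Cb Cb0 HCb] := IH p w.+1 s _ pw1 ssyb.
have stepu u : exists2 C : R, 0 <= C & forall f h, normalized f h -> forall c,
    `|integ (osc f h c s (fun f h x => phase_der u f h x * phase_der u f h x * sy f h x))|
      * h^-1 ^+ p <= C * h^-1 ^+ 2.
  have [sy' ssy' [sy1 ssy1 E]] := osc_by_parts u s ssy.
  have [C' C'0 HC'] := IH p w.+1 s _ pw1 ssy'.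
  have [C1 C10 HC1] := IH p.+1 w (u :: s) _ pw2 ssy1.
  exists (C' + C1); first exact: addr_ge0.
  move=> f h gfh c; have [_ h1 _] := gfh; have := E f h gfh c.
  set J := integ _; set J' := integ _; set J1 := integ _ => JE.
  have pi2 : 1 <= 2 * pi :> R by have := @pi_ge2 R; lra.
  have H' := HC' f h gfh (c - pi / 2); have H1 := HC1 f h gfh (c - pi / 2).
  have JJ : `|J| <= `|J'| + h^-1 * `|J1|.
    apply: (@le_trans _ _ `|2 * pi * J|).
      by rewrite normrM ler_peMl// ger0_norm//; lra.
    rewrite JE (le_trans (ler_normB _ _))// normrN normrM (ger0_norm (x := h^-1))//.
    by rewrite invr_ge0; lra.
  apply: le_trans (ler_wpM2r _ JJ) _; first by case/andP: (hp h p h1).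
  rewrite mulrDl mulrDl; apply: lerD => //; move: H1; rewrite -/J1 exprS.
  by rewrite mulrCA mulrA.
(* The constants depend on the direction [u]; they are collected into a function in order to be
   summed. *)
have [Cu HCu] := choice (fun u => let: ex_intro2 C C0 HC := stepu u in
  ex_intro (fun C => 0 <= C /\ forall f h, normalized f h -> forall c,
    `|integ (osc f h c s (fun f h x => phase_der u f h x * phase_der u f h x * sy f h x))|
      * h^-1 ^+ p <= C * h^-1 ^+ 2) C (conj C0 HC)).
exists (\sum_u Cu u + Cb); first by rewrite addr_ge0// sumr_ge0// => u _; case: (HCu u).
move=> f h gfh c; have [adm h1 _] := gfh.
have ssu u := symbol_mul (symbol_mul (symbol_phase_der u) (symbol_phase_der u)) ssy.
have ccu u := box_continuous_osc c s gfh (ssu u).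
have ccb := box_continuous_osc c s gfh ssyb.
have ccu2 u := box_continuousZ 2^-1 (ccu u).
(* The identity of [phase_der_split] is inserted: the squares of [phase_der] are integrated by
   parts, while [jet2] already raises the weight. *)
have -> : osc f h c s sy = fun x =>
   \sum_u 2^-1 * osc f h c s (fun f h x => phase_der u f h x * phase_der u f h x * sy f h x) x +
   osc f h c s (fun f h x => jet2 f h x * sy f h x) x.
  apply/funext => x; rewrite -[LHS]mulr1 -[X in _ * X = _](phase_der_split x adm).
  rewrite mulrDr mulr_sumr.
  congr (_ + _); last by rewrite /osc; ring.
  by apply: eq_bigr => u _; rewrite /osc; ring.
rewrite intD//; last exact: box_continuous_sum.
rewrite int_sum//.
apply: le_trans (ler_wpM2r _ (ler_normD _ _)) _; first by case/andP: (hp h p h1).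
rewrite !mulrDl; apply: lerD; last exact: HCb.
apply: le_trans (ler_wpM2r _ (ler_norm_sum _ _ _)) _; first by case/andP: (hp h p h1).
rewrite !mulr_suml; apply: ler_sum => u _.
rewrite intZ// normrM -mulrA.
have [_ /(_ f h gfh c) H] := HCu u.
apply: le_trans H; rewrite ler_piMl//.
  by rewrite mulr_ge0//; case/andP: (hp h p h1).
by rewrite ger0_norm; lra.
Qed.

(** The bound without [h] serves when the infimum of the height is below 1, the other when it is at
    least 1. *)
Lemma cos_phase_integral : exists2 C : R, 0 <= C & forall f c,
  [/\ box_continuous (fun x => cos (phase f c x) * chi x),
      `|integ (fun x => cos (phase f c x) * chi x)| <= C &
      forall h, normalized f h ->
        `|integ (fun x => cos (phase f c x) * chi x)| <= C * h^-1 ^+ 2].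
Proof.
have B0 := le_trans ler01 B1.
(* The induction starts from the symbol 1, with [p = w = 0] and five steps to go. *)
have [C C0 HC] := @osc_decay 5 0 0 [::] _ isT (@symbol_cst R n d 1).
have [M M0 HM] := dchi_bounded [::].
have V0 : 0 <= M * (2 * B) ^+ m by rewrite mulr_ge0// exprn_ge0// mulr_ge0.
exists (C + M * (2 * B) ^+ m); first exact: addr_ge0.
move=> f c; have ccG : box_continuous (fun x => cos (phase f c x) * chi x).
  apply: box_continuous_cos; split; first exact: (@continuous_dchi [::]).
  by move=> x /off_box; exact: chi0.
split=> // [|h gfh].
  apply: (@le_trans _ _ (M * (2 * B) ^+ m)); last by rewrite lerDr.
  apply: (@normr_int_le _ (fun=> M)) => //; last by rewrite integral_box_cst.
  move=> t _; rewrite normrM -[leRHS]mul1r; apply: ler_pM => //.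
  by rewrite ler_norml cos_geN1 cos_le1.
have := HC f h gfh c; rewrite expr0 mulr1 /osc.
under [X in integ X]eq_fun do rewrite mul1r.
move=> /le_trans; apply; rewrite ler_wpM2r ?lerDl//.
have [_ h1 _] := gfh; rewrite exprn_ge0// invr_ge0; exact: le_trans h1.
Qed.

End oscillatory_estimate.

(** * The theorem *)

Lemma compact_coord_bounded (R : realType) m (S : set 'rV[R]_m) : compact S ->
  exists2 B : R, 1 <= B & forall x, S x -> forall j, `|x ord0 j| <= B.
Proof.
move=> /(@compact_bounded R)[M [_ /(_ (`|M| + 1))]].
rewrite (le_lt_trans (ler_norm _)) ?ltrDl// => /(_ isT) HM.
exists (`|M| + 2); first by rewrite ler_wpDl//; lra.
move=> x Sx j; have xM := HM x Sx.
have : ball (0 : 'rV[R]_m) (`|M| + 2) x.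
  by rewrite mx_norm_ball /ball_/= sub0r normrN (le_lt_trans xM)// ltrD2l; lra.
by move=> [_ /(_ ord0 j)]; rewrite /ball/= mxE sub0r normrN => /ltW.
Qed.

(** * The exponential as shifted cosines, the height in terms of jets *)

Section reduction_to_symbols.
Context {R : realType}.
Variables n d : nat.
Implicit Types (f : mpoly n R[i]) (phi : 'rV[R[i]]_n -> R[i]).

Lemma normc_le_ReIm (a b : R) : normc (a +i* b) <= `|a| + `|b|.
Proof.
rewrite /= -(@ger0_norm _ (`|a| + `|b|)) ?addr_ge0// -sqrtr_sqr.
rewrite ler_wsqrtr// sqrrD !real_normK ?num_real// -addrA lerD2l lerDr.
by rewrite mulrn_wge0// mulr_ge0.
Qed.

Lemma normc_nat k : normc (k%:R : R[i]) = k%:R.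
Proof.
by rewrite -(rmorph_nat (real_complex R)) /= expr0n addr0 sqrtr_sqr normr_nat.
Qed.

(** The two factors of [e_] combine into one with angle [2 * pi * (Re + Im)], and its sine is a
    cosine shifted by [pi / 2]. *)
Lemma e_phase f (x : 'rV[R]_(n + n)) :
  e_ (evalC f (toC x)) = cos (phase f 0 x) +i* cos (phase f (- (pi / 2)) x).
Proof.
have E : phase f 0 x = 2 * pi * complex.Re (evalC f (toC x)) +
    2 * pi * complex.Im (evalC f (toC x)) by rewrite /phase addr0 -mulrDr.
have -> : cos (phase f (- (pi / 2)) x) = sin (phase f 0 x).
  by rewrite -cosBpihalf /phase addr0.
rewrite E cosD sinD /e_ /cis.
by apply/eqP; rewrite eq_complex cReM cImM /= eqxx addrC eqxx.
Qed.

(** The height is attained at some [a], necessarily with [|a| <= d] since it is positive. Raising to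
    the power [|a|] and dropping the division by the multi-factorial, which is at least 1, shows
    that this one term of [jetQ] is at least 1. *)
Lemma H_ge_jetQ f (h : R) (x : 'rV[R]_(n + n)) : 0 < h -> has_degree d f ->
  h <= H_ f (toC x) -> (0 < d)%N /\ 1 <= jetQ d f h x.
Proof.
move=> h0 fd hH.
case: n f x fd hH => [|n'] f x fd hH.
  move: hH; suff -> : H_ f (toC x) = 0 by rewrite leNgt h0.
  rewrite /H_ (_ : [set _ | _ in _] = set0) ?sup0//.
  apply/seteqP; split => // y [a /= a0 _]; move: a0.
  by rewrite mdegE big_ord0.
have [[a a0 Ha] _] := H_max f (toC x).
have ad : (mdeg a <= d)%N.
  rewrite leqNgt; apply/negP => da; move: hH; rewrite Ha Hterm_eq0 ?fd//.
  by rewrite leNgt h0.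
split; first exact: leq_trans ad.
apply: le_trans (@jetN_le_jetQ R _ d a f h x _); last by rewrite a0.
have hn0 := ltW h0; have n0 := normc_nneg.
have p0 : 0 <= h^-1 ^+ mdeg a * normc (evalC (mderivm a f) (toC x)).
  by apply: mulr_ge0; [rewrite exprn_ge0// invr_ge0|exact: n0].
rewrite jetNE expr_ge1//.
rewrite exprVn mulrC ler_pdivlMr ?exprn_gt0// mul1r.
move: hH; rewrite Ha /Hterm; set y := normc (_ / _) => hy.
have y0 : 0 <= y by exact: n0.
have : h ^+ mdeg a <= y.
  have := lerXn2r (mdeg a) (hn0 : h \is Num.nneg) (powR_ge0 _ _ : _ \is Num.nneg) hy.
  by rewrite -[in leRHS]powR_mulrn ?powR_ge0// -powRrM mulVf ?powRr1// pnatr_eq0 -lt0n.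
move=> /le_trans; apply.
rewrite /y normcM normcV; apply: ler_piMr; first exact: n0.
rewrite normc_nat.
have F1 : 1 <= (mfactorial a)%:R :> R.
  by rewrite ler1n /mfactorial prodn_gt0// => k; exact: fact_gt0.
by rewrite invf_le1// (lt_le_trans ltr01).
Qed.

End reduction_to_symbols.

Theorem theorem1p1 (R : realType) (n d : nat) (phi : 'rV[R[i]]_n -> R[i])
    (hphi : Cc_smooth phi) :
  exists2 C : R, 0 < C &
    forall f : mpoly n R[i], has_degree d f ->
      ((normc (I_ phi (evalC f)))%:E <= C%:E * (Hinf f phi ^+ 2)^-1)%E.
Proof.
case: hphi => sR sI cS; pose S := real_supp phi.
have clS : closed S by exact: closed_closure.
have offS x : ~ S x -> phi (toC x) = 0.
  by move=> nS; apply/eqP; apply: contra_notT nS => p0; exact: subset_closure.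
have [B B1 SB] := compact_coord_bounded cS.
have [CR CR0 HR] := @cos_phase_integral R n d _ S B sR cS clS
  (fun x nS => congr1 (@complex.Re R) (offS x nS)) B1 SB.
have [CI CI0 HI] := @cos_phase_integral R n d _ S B sI cS clS
  (fun x nS => congr1 (@complex.Im R) (offS x nS)) B1 SB.
(* [IE] involves two integrals for the real part of [phi] and two for its imaginary part; the 1
   makes the constant positive. *)
set C := 2 * (CR + CI) + 1.
have C1 : 0 < C by rewrite /C; lra.
have IE f : normc (I_ phi (evalC f)) <=
   `|integ (fun x => cos (phase f 0 x) * complex.Re (phi (toC x)))| +
   `|integ (fun x => cos (phase f (- (pi / 2)) x) * complex.Im (phi (toC x)))| +
   (`|integ (fun x => cos (phase f 0 x) * complex.Im (phi (toC x)))| +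
   `|integ (fun x => cos (phase f (- (pi / 2)) x) * complex.Re (phi (toC x)))|).
  have [r0 _ _] := HR f 0; have [r1 _ _] := HR f (- (pi / 2)).
  have [i0 _ _] := HI f 0; have [i1 _ _] := HI f (- (pi / 2)).
  apply: le_trans (normc_le_ReIm _ _) _; apply: lerD.
    rewrite (_ : Rintegral _ _ _ = integ (fun x =>
      cos (phase f 0 x) * complex.Re (phi (toC x)) +
      -1 * (cos (phase f (- (pi / 2)) x) * complex.Im (phi (toC x))))).
      rewrite (intD B1)//; last exact: box_continuousZ.
      by rewrite (intZ B1)// mulN1r (le_trans (ler_normB _ _)).
    apply: eq_Rintegral => t _; rewrite -/(rowt t) e_phase.
    by rewrite cReM /= mulN1r.
  rewrite (_ : Rintegral _ _ _ = integ (fun x =>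
      cos (phase f 0 x) * complex.Im (phi (toC x)) +
      cos (phase f (- (pi / 2)) x) * complex.Re (phi (toC x)))).
    by rewrite (intD B1)// ler_normD.
  by apply: eq_Rintegral => t _; rewrite -/(rowt t) e_phase cImM.
exists C => // f fd.
have Hge0 (g : mpoly n R[i]) z : 0 <= H_ g z.
  rewrite /H_; have [->|/set0P[y Hy]] := eqVneq [set Hterm g z a | a in
    [set a : multinom n | (0 < mdeg a)%N]] set0; first by rewrite sup0.
  have [hs|hs] := pselect (has_sup [set Hterm g z a | a in
    [set a : multinom n | (0 < mdeg a)%N]]); last by rewrite sup_out.
  apply: le_trans (ub_le_sup hs.2 Hy).
  by case: Hy => a _ <-; exact: powR_ge0.
have Hinf0 : (0 <= Hinf f phi)%E.
  by apply/ereal_infP => _ [z _ <-]; rewrite lee_fin.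
(* Over an empty support the integral is 0 and the right-hand side is nonnegative. *)
have [S0|/set0P[x0 Sx0]] := eqVneq S set0.
  have -> : I_ phi (evalC f) = 0.
    have z x : phi (toC x) = 0 by apply: offS; rewrite S0.
    rewrite /I_ /integralC; congr (_ +i* _); rewrite /Rintegral integral0_eq// => t _;
      by rewrite z mulr0.
  rewrite normc0; apply: mule_ge0; first by rewrite lee_fin ltW.
  by rewrite inve_ge0 expe2; exact: mule_ge0.
have Hx x : S x -> (Hinf f phi <= (H_ f (toC x))%:E)%E.
  by move=> Sx; apply: ereal_inf_lbound; exists (toC x) => //; exists x.
have HinfE : Hinf f phi \is a fin_num.
  by rewrite ge0_fin_numE// (le_lt_trans (Hx _ Sx0))// ltry.
move: HinfE Hinf0 Hx; case: (Hinf f phi) => // h _; rewrite lee_fin le_eqVlt.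
(* If the infimum is 0, its inverse in the extended reals is [+oo] and the bound is trivial. *)
move=> /predU1P[<- _|h0 Hx].
  by rewrite expe2 mule0 inve0 gt0_muley ?lte_fin// leey.
rewrite -EFin_expe inver sqrf_eq0 gt_eqF// -EFinM lee_fin.
apply: le_trans (IE f) _.
have [_ r0 r0'] := HR f 0; have [_ r1 r1'] := HR f (- (pi / 2)).
have [_ i0 i0'] := HI f 0; have [_ i1 i1'] := HI f (- (pi / 2)).
have h2 : 0 <= (h ^+ 2)^-1 by rewrite invr_ge0 sqr_ge0.
(* For [h < 1] the bound without decay suffices, as [h^-2] is then at least 1. *)
have [h1|h1] := leP 1 h.
  have gfh : normalized d S f h.
    split=> [||x Sx]; [|exact: h1|]; last first.
      by have [] := @H_ge_jetQ _ n d f h x h0 fd _; rewrite // -lee_fin; exact: Hx.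
    split=> //; have [] := @H_ge_jetQ _ n d f h x0 h0 fd _; rewrite // -lee_fin.
    exact: Hx.
  have := r0' h gfh; have := r1' h gfh; have := i0' h gfh; have := i1' h gfh.
  rewrite exprVn; move: (h ^+ 2)^-1 h2 => q q0.
  have -> : C * q = 2 * (CR * q) + 2 * (CI * q) + q by rewrite /C; ring.
  by lra.
have hC : C <= C / h ^+ 2.
  rewrite ler_peMr ?(ltW C1)// invf_ge1 ?exprn_gt0// exprn_ile1//; exact: ltW.
by apply: le_trans hC; rewrite /C; lra.
Qed.
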